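(* Let $K$ be a field of characteristic $0$, and let $n,d$ be integers with $d\geq n+1$. Put $q=\lfloor d/n\rfloor$, $a=(q+1)n-d$, $b=d-nq$, and $E=\mathcal{O}_{\mathbb{P}^1}(d+q)^{\oplus a}\oplus\mathcal{O}_{\mathbb{P}^1}(d+q+1)^{\oplus b}$. Suppose $(n,d)$ is one of the following: $n=2$ and $3\le d\le 25$; $n=3$ and $4\le d\le 17$; $n=4$ and $6\le d\le 12$; $n=5$ and $7\le d\le 9$. Then for a general morphism $f:\mathcal{O}_{\mathbb{P}^1}(2)\to E$ (i.e. for all $f$ in a nonempty Zariski open subset of $\operatorname{Hom}(\mathcal{O}_{\mathbb{P}^1}(2),E)$), there exists a rational curve $\phi:\mathbb{P}^1\to\mathbb{P}^n$ of degree $d$ such that $f$ equals the composition of the tangent map $d\phi: T_{\mathbb{P}^1}=\mathcal{O}_{\mathbb{P}^1}(2)\to\phi^*T_{\mathbb{P}^n}$ with an identification $\phi^*T_{\mathbb{P}^n}\cong E$.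
   Context: A rational curve of degree $d$ in $\mathbb{P}^n$ is a morphism $\phi:\mathbb{P}^1\to\mathbb{P}^n$, $[s:t]\mapsto[G_0(s,t):\dots:G_n(s,t)]$, where $G_0,\dots,G_n$ are homogeneous polynomials of degree $d$ with no common zero. For a general such curve the restricted tangent bundle $\phi^*T_{\mathbb{P}^n}$ (of degree $(n+1)d$) is isomorphic to the balanced bundle $E$ above, and $f=\phi^*\circ d\phi$ denotes the composite $\mathcal{O}_{\mathbb{P}^1}(2)=T_{\mathbb{P}^1}\xrightarrow{d\phi}\phi^*T_{\mathbb{P}^n}\cong E$. *)

(* Defs.v *)
From HB Require Import structures.
From mathcomp Require Import all_boot all_order all_algebra all_field.
From mathcomp Require Import mpoly.
Set Implicit Arguments. Unset Strict Implicit. Unset Printing Implicit Defensive.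
Import Order.TTheory GRing.Theory.
Local Open Scope ring_scope.

Definition qnd (n d : nat) : nat := (d %/ n)%N.
Definition acnt (n d : nat) : nat := ((qnd n d).+1 * n - d)%N.
Definition edeg (n d : nat) (j : 'I_n) : nat :=
  if (nat_of_ord j < acnt n d)%N then addn d (qnd n d) else (addn d (qnd n d)).+1.

Arguments edeg : clear implicits.

(* dim Hom(O(2), E) = sum_j h^0(O(e_j - 2)) = sum_j (e_j - 1) *)
Definition homdim (n d : nat) : nat := (\sum_(j < n) (edeg n d j).-1)%N.
Definition homoff (n d : nat) (j : 'I_n) : nat :=
  (\sum_(i < n | (i < j)%N) (edeg n d i).-1)%N.
Arguments homoff : clear implicits.

Definition vs {L : fieldType} : {mpoly L[2]} := 'X_(ord0 : 'I_2).
Definition vt {L : fieldType} : {mpoly L[2]} := 'X_(ord_max : 'I_2).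

(* the k-th coordinate (0 outside range, never used there) *)
Definition coordAt {L : fieldType} (N : nat) (c : 'I_N -> L) (k : nat) : L :=
  if insub k is Some i then c i else 0.

(* The element f = (f_j)_j of Hom(O(2),E) = (+)_j H^0(O(e_j - 2)) with
   coordinate vector c: f_j = sum_k c_(off j + k) s^k t^(e_j - 2 - k). *)
Definition homOf {L : fieldType} (n d : nat) (c : 'I_(homdim n d) -> L)
    (j : 'I_n) : {mpoly L[2]} :=
  \sum_(k < (edeg n d j).-1)
     coordAt c (homoff n d j + k) *: (vs ^+ k * vt ^+ ((edeg n d j).-2 - k)).

Definition nonzero_pt {L : fieldType} (x : 'I_2 -> L) : Prop :=
  x ord0 != 0 \/ x ord_max != 0.

(* f : O(2) -> E equals (iso phi^*T_{P^n} ~ E) o dphi for a degree-d rational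
   curve phi = [G_0 : ... : G_n].  Via the Euler sequences
     0 -> O --(G_i)--> O(d)^{n+1} -> phi^*T_{P^n} -> 0,
     0 -> O --(s,t)--> O(1)^2 -> T_{P^1} = O(2) -> 0,  (u,v) |-> t u - s v,
   with dphi induced by (u,v) |-> (u dG_i/ds + v dG_i/dt)_i,
   an isomorphism phi^*T_{P^n} ~ E is the same as a bundle map
   M : O(d)^{n+1} -> E (entries M j i forms of degree e_j - d) which is
   surjective on every fibre and kills (G_i)_i. *)
Definition realizes {L : fieldType} (n d : nat) (f : 'I_n -> {mpoly L[2]}) :
    Prop :=
  exists G : 'I_n.+1 -> {mpoly L[2]},
    (forall i, G i \is d.-homog) /\
    (forall x : 'I_2 -> L, nonzero_pt x -> exists i, meval x (G i) != 0) /\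
    exists M : 'I_n -> 'I_n.+1 -> {mpoly L[2]},
      (forall j i, M j i \is (edeg n d j - d)%N.-homog) /\
      (forall j, \sum_(i < n.+1) M j i * G i = 0) /\
      (forall x : 'I_2 -> L, nonzero_pt x ->
          row_free (\matrix_(j < n, i < n.+1) meval x (M j i))) /\
      (forall j, \sum_(i < n.+1) M j i * mderiv ord0 (G i) = vt * f j) /\
      (forall j, \sum_(i < n.+1) M j i * mderiv ord_max (G i) = - (vs * f j)).

Definition theorem1p2_cases (n d : nat) : bool :=
  [|| (n == 2) && (3 <= d <= 25), (n == 3) && (4 <= d <= 17),
      (n == 4) && (6 <= d <= 12) | (n == 5) && (7 <= d <= 9)]%N.
Arguments homOf {L} n d c j.
Arguments realizes {L} n d f.

(* Main.v *)
(* Write [M] for a general [n x (n+1)] matrix of binary forms whose [j]-th row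
   has degree [edeg j - d].  Its signed maximal minors [G_i] have degree [d] and
   satisfy [M G = 0], so [M] presents the restricted tangent bundle of the curve
   [G] and [sum_i M_ji dG_i/ds = t f_j] recovers [f].  This makes [f] a
   polynomial function [Phi] of the coefficients of [M].  A general [f] has no
   common zero, and a common zero of the [G_i] would be one of [f] (differentiate
   [M G = 0] there); so it suffices that [Phi] is dominant.
   In characteristic 0 this follows from the surjectivity of the differential
   of [Phi] at one integer point, which survives reduction modulo a prime: in
   each case it is checked modulo 127 by computing with dual numbers and Gaussian
   elimination.  The passage from dominance to "the image contains a nonempty open
   set defined over [K]" is Chevalley's argument: a homomorphism from a subring of
   a domain to an algebraically closed field extends to a finitely generated
   overring as soon as it does not kill a suitable nonzero element. *)

From Stdlib Require Import ZArith ClassicalEpsilon.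
Require Import Defs.
From HB Require Import structures.
From mathcomp Require Import all_boot all_order all_algebra all_field.
From mathcomp Require Import perm mpoly ssrZ zify.
Set Implicit Arguments. Unset Strict Implicit. Unset Printing Implicit Defensive.
Import GRing.Theory.
Local Open Scope ring_scope.
Delimit Scope Z_scope with BZ.

(** * Generic extension of homomorphisms *)

Section GenericExtension.
Variables (Omega : idomainType) (L : closedFieldType).
Implicit Types (A B : Omega -> Prop) (phi psi : Omega -> L) (P Q : {poly Omega}).

(** Subrings are predicates and homomorphisms are total functions constrained only on the subring,
    so that a tower of adjunctions stays inside the one type [Omega]. *)
Definition is_subring A :=
  [/\ A 1, forall a b, A a -> A b -> A (a - b) & forall a b, A a -> A b -> A (a * b)].

Definition is_hom_on A phi :=
  [/\ phi 1 = 1, forall a b, A a -> A b -> phi (a - b) = phi a - phi b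
    & forall a b, A a -> A b -> phi (a * b) = phi a * phi b].

Definition coefs_in A P := forall i, A P`_i.

Definition adjoin A (eta : Omega) z := exists2 P, coefs_in A P & z = P.[eta].

(** Keeping a prescribed [g] nonzero makes the property transitive: the [h] of the upper extension
    serves as the [g] of the lower one. *)
Definition extends_generically A B :=
  forall g, B g -> g != 0 -> exists h, [/\ A h, h != 0 &
    forall phi, is_hom_on A phi -> phi h != 0 ->
      exists psi, [/\ is_hom_on B psi, forall a, A a -> psi a = phi a & psi g != 0]].

Section Subring.
Variable A : Omega -> Prop.
Hypothesis sA : is_subring A.

Lemma subring0 : A 0.
Proof. by case: sA => A1 AB _; rewrite -(subrr 1); apply: AB. Qed.

Lemma subringN a : A a -> A (- a).
Proof. by case: sA => _ AB _ Aa; rewrite -sub0r; apply: AB => //; apply: subring0. Qed.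

Lemma subringD a b : A a -> A b -> A (a + b).
Proof.
by case: sA => _ AB _ Aa Ab; rewrite -[b]opprK; apply: AB => //; apply: subringN.
Qed.

Lemma subring_sum I (r : seq I) (E : I -> Omega) :
  (forall i, A (E i)) -> A (\sum_(i <- r) E i).
Proof.
by move=> AE; elim/big_ind: _ => //; [apply: subring0 | apply: subringD].
Qed.

Lemma coefs_inC a : A a -> coefs_in A a%:P.
Proof. by move=> Aa i; rewrite coefC; case: ifP => // _; apply: subring0. Qed.

Lemma coefs_inXn k : coefs_in A 'X^k.
Proof.
by case: sA => A1 _ _ i; rewrite coefXn; case: (_ == _) => //; apply: subring0.
Qed.

Lemma coefs_inB P Q : coefs_in A P -> coefs_in A Q -> coefs_in A (P - Q).
Proof. by case: sA => _ AB _ AP AQ i; rewrite coefB; apply: AB. Qed.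

Lemma coefs_inM P Q : coefs_in A P -> coefs_in A Q -> coefs_in A (P * Q).
Proof.
case: sA => _ _ AM AP AQ i; rewrite coefM.
by apply: subring_sum => j; apply: AM.
Qed.

Lemma adjoin_sub eta a : A a -> adjoin A eta a.
Proof. by exists a%:P; rewrite ?hornerC //; apply: coefs_inC. Qed.

Lemma adjoin_gen eta : adjoin A eta eta.
Proof. by exists 'X; rewrite ?hornerX //; apply: (coefs_inXn 1). Qed.

Lemma adjoin_subring eta : is_subring (adjoin A eta).
Proof.
split; first by apply: adjoin_sub; case: sA.
  move=> _ _ [P AP ->] [Q AQ ->]; exists (P - Q); last by rewrite hornerD hornerN.
  exact: coefs_inB.
move=> _ _ [P AP ->] [Q AQ ->]; exists (P * Q); last by rewrite hornerM.
exact: coefs_inM.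
Qed.

Section Hom.
Variable phi : Omega -> L.
Hypothesis hphi : is_hom_on A phi.

Lemma hom_on0 : phi 0 = 0.
Proof. by case: hphi sA => _ pB _ [A1 _ _]; rewrite -(subrr 1) pB // subrr. Qed.

Lemma hom_onD a b : A a -> A b -> phi (a + b) = phi a + phi b.
Proof.
move=> Aa Ab; case: hphi => _ pB _.
rewrite -[X in _ + X]opprK pB //; last exact: subringN.
by rewrite -[- b]sub0r pB ?hom_on0 ?sub0r ?opprK //; apply: subring0.
Qed.

Lemma hom_on_sum I (r : seq I) (E : I -> Omega) :
  (forall i, A (E i)) -> phi (\sum_(i <- r) E i) = \sum_(i <- r) phi (E i).
Proof.
move=> AE; elim: r => [|i r IH]; first by rewrite !big_nil hom_on0.
by rewrite !big_cons hom_onD ?IH //; apply: subring_sum.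
Qed.

Lemma map_hom_coef P i : (map_poly phi P)`_i = phi P`_i.
Proof. by rewrite coef_map_id0 // hom_on0. Qed.

Lemma map_homC a : map_poly phi a%:P = (phi a)%:P.
Proof.
by apply/polyP=> i; rewrite map_hom_coef !coefC; case: eqP => // _; apply: hom_on0.
Qed.

Lemma map_homB P Q : coefs_in A P -> coefs_in A Q ->
  map_poly phi (P - Q) = map_poly phi P - map_poly phi Q.
Proof.
move=> AP AQ; apply/polyP=> i; rewrite coefB !map_hom_coef coefB.
by case: hphi => _ pB _; apply: pB.
Qed.

Lemma map_homM P Q : coefs_in A P -> coefs_in A Q ->
  map_poly phi (P * Q) = map_poly phi P * map_poly phi Q.
Proof.
move=> AP AQ; apply/polyP=> i; rewrite coefM map_hom_coef coefM.
case: hphi sA => _ _ pM [_ _ AM]; rewrite hom_on_sum; last by move=> j; apply: AM.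
by apply: eq_bigr => j _; rewrite !map_hom_coef pM.
Qed.

(* A relation-preserving choice of the image [y] of [eta] defines a
   homomorphism on [adjoin A eta]; its graph is made a function by choice. *)
Lemma hom_on_adjoin eta y :
  (forall P, coefs_in A P -> P.[eta] = 0 -> (map_poly phi P).[y] = 0) ->
  exists2 psi, is_hom_on (adjoin A eta) psi &
    forall P, coefs_in A P -> psi P.[eta] = (map_poly phi P).[y].
Proof.
move=> Hy.
pose graph z w := exists2 P, coefs_in A P & z = P.[eta] /\ w = (map_poly phi P).[y].
pose psi z := epsilon (inhabits (0 : L)) (graph z).
(* Two representatives of one element differ by a relation, which [Hy] sends to 0; so the value
   picked by [epsilon] does not depend on the representative. *)
have psiE P : coefs_in A P -> psi P.[eta] = (map_poly phi P).[y].
  move=> AP; have : exists w, graph P.[eta] w by exists (map_poly phi P).[y], P.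
  case/(epsilon_spec (inhabits (0 : L))) => Q AQ [ePQ]; rewrite -/(psi _) => ->.
  apply/eqP; rewrite -subr_eq0 -hornerN -hornerD -map_homB //; apply/eqP.
  by apply: Hy; [apply: coefs_inB | rewrite hornerD hornerN -ePQ subrr].
exists psi => //; split.
- have A1 : A 1 by case: sA.
  by rewrite -(hornerC 1 eta) psiE ?map_homC ?hornerC; [case: hphi | apply: coefs_inC].
- move=> _ _ [P AP ->] [Q AQ ->]; rewrite -hornerN -hornerD !psiE ?map_homB ?hornerD ?hornerN //.
  exact: coefs_inB.
- move=> _ _ [P AP ->] [Q AQ ->]; rewrite -hornerM !psiE ?map_homM ?hornerM //.
  exact: coefs_inM.
Qed.

End Hom.

(** One division step that cancels the leading term of [P] without inverting anything, so that
    coefficients stay in [A]. The truncated subtraction is exact under the hypothesis of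
    [size_redp]. *)
Definition redp (P0 P : {poly Omega}) :=
  (lead_coef P0)%:P * P - ((lead_coef P)%:P * 'X^(size P - size P0)) * P0.

Lemma coefs_in_lead P : coefs_in A P -> A (lead_coef P).
Proof. by rewrite lead_coefE. Qed.

Lemma coefs_in_redp P0 P : coefs_in A P0 -> coefs_in A P -> coefs_in A (redp P0 P).
Proof.
move=> A0 AP; apply: coefs_inB.
  by apply: coefs_inM => //; apply/coefs_inC/coefs_in_lead.
apply: coefs_inM => //; apply: coefs_inM; last exact: coefs_inXn.
exact/coefs_inC/coefs_in_lead.
Qed.

Lemma size_redp P0 P : P0 != 0 -> P != 0 -> (size P0 <= size P)%N ->
  (size (redp P0 P) < size P)%N.
Proof.
move=> nz0 nzP le0; set k := (size P - size P0)%N.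
have sP : (0 < size P)%N by rewrite size_poly_gt0.
rewrite -[size P]prednK // ltnS; apply/leq_sizeP => j.
rewrite leq_eqVlt => /orP[/eqP <-|lt_j].
  rewrite /redp coefB coefCM -/k -mulrA coefCM coefXnM.
  have kP : (size P).-1 = (k + (size P0).-1)%N.
    by rewrite -!subn1 /k addnBA ?size_poly_gt0 // subnK.
  by rewrite ltnNge {2 3}kP leq_addr /= addKn -lead_coefE mulrC -lead_coefE subrr.
rewrite /redp coefB coefCM -/k -mulrA coefCM coefXnM.
have le_j : (size P <= j)%N by rewrite -[size P]prednK.
rewrite (nth_default 0 le_j) mulr0; case: ifP => _; first by rewrite mulr0 subr0.
rewrite (_ : P0`_(j - k) = 0) ?mulr0 ?subr0 //; apply: nth_default.
by rewrite leq_subRL; [rewrite /k subnK | apply: leq_trans (leq_subr _ _) _].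
Qed.

Lemma pseudo_div P0 P : coefs_in A P0 -> coefs_in A P -> P0 != 0 ->
  exists (c : Omega) Q R, [/\ A c /\ c != 0, coefs_in A Q, coefs_in A R,
    c%:P * P = Q * P0 + R & (size R < size P0)%N].
Proof.
move=> A0 + nz0; move: {2}(size P).+1 (ltnSn (size P)) => s.
elim: s P => // s IH P; rewrite ltnS => leP AP.
have [le0|lt0] := leqP (size P0) (size P); last first.
  exists 1, 0, P; split=> //; rewrite ?mul0r ?add0r ?mul1r //.
    by split; [case: sA | apply: oner_neq0].
  by move=> i; rewrite coef0; apply: subring0.
have nzP : P != 0 by rewrite -size_poly_gt0 (leq_trans _ le0) // size_poly_gt0.
have [c [Q [R [[Ac nzc] AQ AR eQ szR]]]] :
    exists (c : Omega) Q R, [/\ A c /\ c != 0, coefs_in A Q, coefs_in A R,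
      c%:P * redp P0 P = Q * P0 + R & (size R < size P0)%N].
  apply: IH; last exact: coefs_in_redp.
  exact: leq_trans (size_redp nz0 nzP le0) leP.
have Al P' : coefs_in A P' -> A (lead_coef P') := @coefs_in_lead P'.
have [_ _ AM] := sA.
exists (c * lead_coef P0), (c%:P * ((lead_coef P)%:P * 'X^(size P - size P0)) + Q), R.
split=> //.
- by split; [apply: AM => //; apply: Al | rewrite mulf_neq0 // lead_coef_eq0].
- rewrite -[Q]opprK; apply: coefs_inB.
    apply: coefs_inM; first exact: coefs_inC.
    by apply: coefs_inM; [apply/coefs_inC/Al | apply: coefs_inXn].
  by rewrite -[- Q]sub0r; apply: coefs_inB => // i; rewrite coef0; apply: subring0.
- rewrite rmorphM /= mulrDl -addrA -eQ /redp mulrBr !mulrA addrC subrK //.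
Qed.

(** With no relation on [eta], any [y] may be its image. As the leading coefficient of [P] survives,
    the image of [P] under [phi] is a nonzero polynomial, and the algebraically closed [L] contains
    a non-root of it. *)
Lemma extends_adjoin_transcendental eta :
  (forall P, coefs_in A P -> P.[eta] = 0 -> P = 0) ->
  extends_generically A (adjoin A eta).
Proof.
move=> tr g [P AP ->] nzg; exists (lead_coef P).
have nzP : P != 0 by apply: contraNneq nzg => ->; rewrite horner0.
split; [exact: coefs_in_lead | by rewrite lead_coef_eq0 |].
move=> phi hphi nzl.
have : map_poly phi P != 0.
  by apply: contraNneq nzl => eP; rewrite lead_coefE -map_hom_coef // eP coef0.
case/closed_nonrootP => y Py.
have [psi hpsi psiE] : exists2 psi, is_hom_on (adjoin A eta) psi &
    forall P, coefs_in A P -> psi P.[eta] = (map_poly phi P).[y].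
  apply: hom_on_adjoin => // Q AQ /(tr _ AQ) ->.
  by rewrite map_poly0 horner0.
exists psi; split=> //; last by rewrite psiE.
move=> a Aa; rewrite -(hornerC a eta) psiE ?map_homC ?hornerC //.
exact: coefs_inC.
Qed.

Section Algebraic.
Variables (eta : Omega) (P0 : {poly Omega}).
Hypotheses (A0 : coefs_in A P0) (nz0 : P0 != 0) (P0eta : P0.[eta] = 0).
Hypothesis minP0 : forall P, coefs_in A P -> P.[eta] = 0 -> P != 0 ->
  (size P0 <= size P)%N.

(** Descent on [size P]. A large [P] is reduced by [redp], which at [eta] multiplies by
    [lead_coef P0]. A small nonconstant one divides [P0] with remainder [R]; then [R.[eta] = -
    (Q.[eta] * P.[eta])], and [Q.[eta]] is nonzero by minimality, [Q] being smaller than [P0]. *)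
Lemma multiple_in_base P : coefs_in A P -> P.[eta] != 0 ->
  exists2 Q, coefs_in A Q & A (Q.[eta] * P.[eta]) /\ Q.[eta] * P.[eta] != 0.
Proof.
move: {2}(size P).+1 (ltnSn (size P)) => s.
elim: s P => // s IH P; rewrite ltnS => leP AP nzPe.
have nzP : P != 0 by apply: contraNneq nzPe => ->; rewrite horner0.
have [le0|lt0] := leqP (size P0) (size P).
  have redE : (redp P0 P).[eta] = lead_coef P0 * P.[eta].
    by rewrite /redp hornerD hornerN !hornerM P0eta mulr0 subr0 hornerC.
  have [||Q AQ [AQr nzQr]] := IH (redp P0 P) _ (coefs_in_redp A0 AP).
  - exact: leq_trans (size_redp nz0 nzP le0) leP.
  - by rewrite redE mulf_neq0 // lead_coef_eq0.
  exists (Q * (lead_coef P0)%:P).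
    by apply: coefs_inM => //; apply/coefs_inC/coefs_in_lead.
  by rewrite hornerM hornerC -mulrA -redE.
have [/size1_polyC eP|lt1] := leqP (size P) 1%N.
  exists 1; first by have [A1 _ _] := sA; apply: (coefs_inC A1).
  by rewrite hornerC mul1r; split=> //; rewrite eP hornerC.
have [c [Q [R [[Ac nzc] AQ AR eQ szR]]]] := pseudo_div AP A0 nzP.
have nzQ : Q != 0.
  apply: contraTneq szR => Q0; rewrite Q0 mul0r add0r in eQ.
  by rewrite -leqNgt -eQ mul_polyC size_scale // ltnW.
have szQ : (size Q < size P0)%N.
  have : (size (Q * P)%R <= size P0)%N.
    have -> : Q * P = c%:P * P0 - R by rewrite eQ addrK.
    apply: leq_trans (size_polyD _ _) _; rewrite geq_max mul_polyC size_scale // leqnn.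
    by rewrite size_polyN ltnW // (ltn_trans szR).
  rewrite size_mul //; apply: leq_trans.
  by case: (size P) lt1 => [|[|k]] // _; rewrite !addnS /= ltnS leq_addr.
have nzQe : Q.[eta] != 0.
  by apply: contraTneq szQ => Qe; rewrite -leqNgt; apply: minP0.
have Re : R.[eta] = - (Q.[eta] * P.[eta]).
  have := congr1 (fun p => p.[eta]) eQ.
  rewrite hornerM P0eta mulr0 hornerD hornerM => /esym /eqP.
  by rewrite addrC addr_eq0 => /eqP.
have [||B AB [AB1 nzB1]] := IH R _ AR.
- exact: leq_trans szR leP.
- by rewrite Re oppr_eq0 mulf_neq0.
exists (B * - Q); last by rewrite hornerM hornerN -mulrA mulNr -Re.
apply: coefs_inM => //; rewrite -sub0r; apply: coefs_inB => // i.
by rewrite coef0; apply: subring0.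
Qed.

(** The factor [lead_coef P0] of [h] keeps the image of [P0] nonconstant, hence with a root [y] to
    receive [eta]. The other factor is a multiple of [g] lying in [A]: if [psi g] were 0, its image
    would be 0 too. *)
Lemma extends_adjoin_algebraic : extends_generically A (adjoin A eta).
Proof.
move=> g [P AP ->] nzg; have [Q AQ [Ar nzr]] := multiple_in_base AP nzg.
have [A1 _ AM] := sA; have Al := coefs_in_lead A0.
exists (lead_coef P0 * (Q.[eta] * P.[eta])); split; first exact: AM.
  by rewrite mulf_neq0 // lead_coef_eq0.
move=> phi hphi; have [p1 _ pM] := hphi.
rewrite pM // mulf_eq0 negb_or => /andP[nzl nzphi].
have lt1 : (1 < size P0)%N.
  rewrite ltnNge; apply: contra nz0 => /size1_polyC eP0.
  by move: P0eta; rewrite eP0 hornerC => ->.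
have [y P0y] : exists y, root (map_poly phi P0) y.
  apply/closed_rootP; rewrite gtn_eqF // (leq_trans lt1) //.
  rewrite leqNgt; apply/negP => lt_sz; case/negP: nzl.
  rewrite lead_coefE -map_hom_coef //; apply/eqP/nth_default.
  by rewrite -ltnS prednK // ltnW.
have [psi hpsi psiE] : exists2 psi, is_hom_on (adjoin A eta) psi &
    forall P, coefs_in A P -> psi P.[eta] = (map_poly phi P).[y].
  (* Every relation must vanish at [y]: [redp] yields a smaller relation, whose value at the root
     [y] is [phi (lead_coef P0)] times the original value. *)
  apply: hom_on_adjoin => // {AP Ar nzr nzphi nzg AQ}P.
  move: {2}(size P).+1 (ltnSn (size P)) => s.
  elim: s P => // s IH P; rewrite ltnS => leP AP Pe.
  have [->|nzP] := eqVneq P 0; first by rewrite map_poly0 horner0.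
  have le0 := minP0 AP Pe nzP.
  have := IH (redp P0 P) (leq_trans (size_redp nz0 nzP le0) leP) (coefs_in_redp A0 AP).
  have AlP := coefs_in_lead AP.
  have AlC : coefs_in A (lead_coef P)%:P by apply: coefs_inC.
  have AlX : coefs_in A ((lead_coef P)%:P * 'X^(size P - size P0)).
    by apply: coefs_inM => //; apply: coefs_inXn.
  have Al0 : coefs_in A (lead_coef P0)%:P by apply: coefs_inC.
  rewrite /redp hornerD hornerN !hornerM P0eta Pe !mulr0 subrr => /(_ erefl).
  rewrite map_homB; [|by []|exact: coefs_inM|exact: coefs_inM].
  rewrite hornerD hornerN [map_poly phi (_ * P)]map_homM // map_homC //.
  rewrite [map_poly phi (_ * P0)]map_homM // !hornerM.
  rewrite (rootP P0y) mulr0 subr0 hornerC => /eqP.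
  by rewrite mulf_eq0 (negPf nzl) => /eqP.
exists psi; split=> //.
  move=> a Aa; rewrite -(hornerC a eta) psiE ?map_homC ?hornerC //.
  exact: coefs_inC.
apply: contraNneq nzphi => psi0.
have AC := coefs_inC Ar.
case: hpsi => _ _ psiM; move: (psiE _ AC); rewrite map_homC // !hornerC => <-.
by rewrite psiM ?psi0 ?mulr0 //; [exists Q | exists P].
Qed.

End Algebraic.

Lemma extends_adjoin eta : extends_generically A (adjoin A eta).
Proof.
pose rel s := exists P, [/\ coefs_in A P, P.[eta] = 0, P != 0 & size P = s].
have [[s rs]|none] := excluded_middle_informative (exists s, rel s); last first.
  apply: extends_adjoin_transcendental => P AP Pe; apply/eqP/negP => /negP nzP.
  by apply: none; exists (size P), P.
(* Classical logic turns [rel] into a boolean, so that [ex_minnP] can supply a relation of minimal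
   size. *)
pose relb k := if excluded_middle_informative (rel k) then true else false.
have relP k : reflect (rel k) (relb k).
  by rewrite /relb; case: excluded_middle_informative => ?; constructor.
have : exists k, relb k by exists s; apply/relP.
case/ex_minnP => k /relP [P0 [A0 P0e nz0 sz0]] mink.
apply: (extends_adjoin_algebraic A0 nz0 P0e) => P AP Pe nzP.
by rewrite sz0; apply: mink; apply/relP; exists P.
Qed.

End Subring.

Lemma extends_generically_trans A B C :
  (forall a, A a -> B a) -> extends_generically A B -> extends_generically B C ->
  extends_generically A C.
Proof.
move=> sAB eAB eBC g Cg nzg; have [h1 [Bh1 nzh1 e1]] := eBC g Cg nzg.
have [h [Ah nzh e]] := eAB h1 Bh1 nzh1; exists h; split=> // phi hphi nzphi.
have [psi1 [hpsi1 psi1E nzpsi1]] := e phi hphi nzphi.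
have [psi [hpsi psiE nzpsi]] := e1 psi1 hpsi1 nzpsi1.
by exists psi; split=> // a Aa; rewrite psiE ?psi1E //; apply: sAB.
Qed.

Lemma extends_adjoin_seq A s : is_subring A ->
  let B := foldl adjoin A s in
  [/\ is_subring B, forall a, A a -> B a, forall x, x \in s -> B x &
      extends_generically A B].
Proof.
elim: s A => [|x s IH] A sA /=.
  by split=> // g Ag nzg; exists g; split=> // phi hphi nzphi; exists phi.
have [sB sub gen ext] := IH _ (adjoin_subring sA x).
have subA a : A a -> adjoin A x a by apply: adjoin_sub.
split=> //; first by move=> a /subA /sub.
  by move=> y; rewrite inE => /orP[/eqP ->|/gen //]; apply/sub/adjoin_gen.
by apply: extends_generically_trans ext => //; apply: extends_adjoin.
Qed.

End GenericExtension.

(** By independence a point [c] is a homomorphism to [L] from the subring [A] generated over [K] by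
    the [F l]. An extension of it to all polynomials sends the variables to a preimage [x], and
    generic extension with [g = 1] supplies [h]. *)
Lemma generic_lift (K : fieldType) (L : closedFieldType) (iota : {rmorphism K -> L})
    (N m : nat) (F : 'I_N -> {mpoly K[m]}) :
  (forall P, mmap (@mpolyC m K) F P = 0 -> P = 0) ->
  exists2 h : {mpoly K[N]}, h != 0 &
    forall c : 'I_N -> L, meval c (map_mpoly iota h) != 0 ->
      exists x : 'I_m -> L, forall l, meval x (map_mpoly iota (F l)) = c l.
Proof.
move=> indep; pose ev := mmap (@mpolyC m K) F.
have ev_inj : injective ev.
  move=> P Q eq_ev; apply/eqP; rewrite -subr_eq0; apply/eqP/indep.
  by rewrite raddfB /=; apply/eqP; rewrite subr_eq0; apply/eqP.
pose A (z : {mpoly K[m]}) := exists P, z = ev P.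
have sA : is_subring A.
  split; first by exists 1; rewrite /ev rmorph1.
    by move=> _ _ [P ->] [Q ->]; exists (P - Q); rewrite /ev rmorphB.
  by move=> _ _ [P ->] [Q ->]; exists (P * Q); rewrite /ev rmorphM.
have [] := extends_adjoin_seq L [seq 'X_i | i <- enum 'I_m] sA.
set B := foldl _ _ _ => sB subAB genB ext.
(* Adjoining all the variables to [A] gives the whole polynomial ring. *)
have Bfull P : B P.
  have BC c : B c%:MP by apply: subAB; exists c%:MP; rewrite /ev mmapC.
  have [B1 _ BM] := sB.
  rewrite [P]mpolyE; apply: subring_sum => // mm; rewrite -mul_mpolyC; apply: (BM) => //.
  rewrite mpolyXE_id; elim: (index_enum _) => [|i r IHr]; rewrite ?big_nil ?big_cons //.
  apply: (BM) => //; elim: (mm i) => [|k IHk]; rewrite ?expr0 ?exprS //; apply: (BM) => //.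
  by apply: genB; apply: map_f; rewrite mem_enum.
have [h [[P ->] nzh spec]] := ext 1 (Bfull 1) (oner_neq0 _).
exists P; first by apply: contraNneq nzh => ->; rewrite /ev raddf0.
move=> c nzc.
pose phi z := epsilon (inhabits (0 : L))
  (fun w => exists2 Q, z = ev Q & w = meval c (map_mpoly iota Q)).
have phiE Q : phi (ev Q) = meval c (map_mpoly iota Q).
  have : exists w, exists2 Q', ev Q = ev Q' & w = meval c (map_mpoly iota Q').
    by exists (meval c (map_mpoly iota Q)), Q.
  by case/(epsilon_spec (inhabits (0 : L))) => Q' eQ; rewrite -/(phi _) => ->;
    rewrite (ev_inj _ _ eQ).
have hphi : is_hom_on A phi.
  split.
  - have <- : ev 1 = 1 by rewrite /ev rmorph1.
    by rewrite phiE !rmorph1.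
  - move=> _ _ [Q ->] [Q' ->].
    have -> : ev Q - ev Q' = ev (Q - Q') by rewrite /ev rmorphB.
    by rewrite !phiE !rmorphB.
  - move=> _ _ [Q ->] [Q' ->].
    have -> : ev Q * ev Q' = ev (Q * Q') by rewrite /ev rmorphM.
    by rewrite !phiE !rmorphM.
have [|psi [hpsi psiE _]] := spec phi hphi; first by rewrite phiE.
exists (fun i => psi 'X_i) => l.
have -> : c l = psi (F l).
  have eF : F l = ev 'X_l by rewrite /ev mmapX mmap1U.
  by rewrite eF psiE; [rewrite phiE map_mpolyX mevalXU | exists 'X_l].
have psiC k : psi k%:MP = iota k.
  have e : k%:MP = ev k%:MP by rewrite /ev mmapC.
  by rewrite {1}e psiE; [rewrite phiE map_mpolyC mevalC | exists k%:MP].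
have [p1 _ pM] := hpsi.
rewrite (mpolyE (F l)) (hom_on_sum sB hpsi) => [|mm]; last exact: Bfull.
rewrite (raddf_sum (map_mpoly iota)) (raddf_sum (meval _)) /=; apply: eq_bigr => mm _.
rewrite map_mpolyZ mevalZ map_mpolyX mevalX -mul_mpolyC pM // psiC; congr (_ * _).
rewrite mpolyXE_id; elim: (index_enum _) => [|i r IH]; first by rewrite !big_nil p1.
rewrite !big_cons pM // IH; congr (_ * _).
by elim: (mm i) => [|k IHk]; rewrite ?expr0 ?p1 // !exprS pM // IHk.
Qed.

(** * The Jacobian criterion *)

(** Induction over the ring operations suits identities between derivations, where the product rule
    settles the last case. *)
Lemma mpoly_ring_ind (R : comNzRingType) n (T : {mpoly R[n]} -> Prop) :
  (forall c, T c%:MP) -> (forall i, T 'X_i) ->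
  (forall P Q, T P -> T Q -> T (P + Q)) -> (forall P Q, T P -> T Q -> T (P * Q)) ->
  forall P, T P.
Proof.
move=> TC TX TD TM P; rewrite [P]mpolyE; elim/big_ind: _ => [||m _].
- by rewrite -mpolyC0.
- exact: TD.
rewrite -mul_mpolyC mpolyXE_id; apply: (TM) => //; elim/big_ind: _ => // [|i _].
  by rewrite -mpolyC1.
by elim: (m i) => [|k IH]; rewrite ?expr0 -?mpolyC1 // exprS; apply: (TM).
Qed.

Lemma mmap_chain_rule (R : comNzRingType) N m (F : 'I_N -> {mpoly R[m]}) t P :
  (mmap (@mpolyC m R) F P)^`M(t) =
  \sum_l mmap (@mpolyC m R) F P^`M(l) * (F l)^`M(t).
Proof.
elim/mpoly_ring_ind: P => [c|i|P Q IHP IHQ|P Q IHP IHQ].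
- by rewrite mmapC mderivC big1 // => l _; rewrite mderivC mmap0 mul0r.
- rewrite mmapX mmap1U (bigD1 i) //= big1 ?addr0 => [|l ne].
    rewrite mderivX mnm1E eqxx (_ : _ - _ = 0)%MM ?scale1r ?mpolyX0 ?rmorph1 ?mul1r //.
    by apply/mnmP=> j; rewrite mnmBE mnm0E subnn.
  by rewrite mderivX mnm1E eq_sym (negPf ne) scale0r mmap0 mul0r.
- rewrite mmapD mderivD IHP IHQ -big_split; apply: eq_bigr => l _ /=.
  by rewrite mderivD mmapD mulrDl.
- rewrite rmorphM mderivM IHP IHQ mulr_suml mulr_sumr -big_split.
  apply: eq_bigr => l _ /=.
  by rewrite mderivM mmapD !rmorphM /= mulrDl mulrAC !mulrA.
Qed.

Lemma msize_mderiv_lt (R : comNzRingType) n i (P : {mpoly R[n]}) :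
  P^`M(i) != 0 -> (msize P^`M(i) < msize P)%N.
Proof.
move=> nz; suff: (msize P^`M(i) <= (msize P).-1)%N.
  have: (0 < msize P)%N.
    by rewrite lt0n msize_poly_eq0; apply: contraNneq nz => ->; rewrite mderiv0.
  by case: (msize P).
rewrite mmeasureE; apply/bigmax_leqP_seq => m; rewrite mcoeff_msupp mcoeff_mderiv => nzm _.
have /msize_mdeg_lt : (m + U_(i))%MM \in msupp P.
  by rewrite mcoeff_msupp; apply: contraNneq nzm => ->; rewrite mul0rn.
by rewrite mdegD mdeg1 addn1; case: (msize P).
Qed.

Lemma mderiv_eq0_const (K : fieldType) n (P : {mpoly K[n]}) :
  [pchar K] =i pred0 -> (forall i, P^`M(i) = 0) -> P = (P@_(0%MM))%:MP.
Proof.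
move=> ch0 dP; apply/mpolyP => m; rewrite mcoeffC.
have [->|nzm] := eqVneq m 0%MM; first by rewrite mulr1.
rewrite mulr0; have [i mi] : exists i, m i != 0%N.
  apply/existsP; apply: contraNT nzm; rewrite negb_exists => /forallP m0.
  by apply/eqP/mnmP => i; rewrite mnm0E; apply/eqP; rewrite -[_ == _]negbK m0.
have mE : ((m - U_(i)) + U_(i))%MM = m.
  by apply: submK; rewrite lep1mP.
have /eqP := mcoeff_mderiv i P (m - U_(i))%MM.
rewrite dP mcoeff0 mE eq_sym -mulr_natr mulf_eq0 => /orP[/eqP //|].
by have /pcharf0P -> := ch0.
Qed.

(* Jacobian criterion: differentiating a relation of minimal degree gives
   relations of smaller degree, hence a constant one in characteristic 0. *)
Lemma jacobian_indep (K : fieldType) N m (F : 'I_N -> {mpoly K[m]}) (f : 'I_N -> 'I_m) :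
  [pchar K] =i pred0 -> \det (\matrix_(a, l) (F l)^`M(f a)) != 0 ->
  forall P, mmap (@mpolyC m K) F P = 0 -> P = 0.
Proof.
move=> ch0 nzdet P; move: {2}(msize P).+1 (ltnSn (msize P)) => s.
elim: s P => // s IH P; rewrite ltnS => leP PF0.
have dP l : P^`M(l) = 0.
  have [//|nzd] := eqVneq P^`M(l) 0.
  apply: IH; first exact: leq_trans (msize_mderiv_lt nzd) leP.
  set J := \matrix_(_, _) _ in nzdet.
  pose v := \col_l mmap (@mpolyC m K) F P^`M(l).
  (* By the chain rule [v] lies in the kernel of the Jacobian matrix; multiplying by the adjugate
     then gives [v = 0], as the determinant is nonzero. *)
  have Jv : J *m v = 0.
    apply/matrixP=> a b; rewrite !mxE.
    transitivity ((mmap (@mpolyC m K) F P)^`M(f a)); last by rewrite PF0 mderiv0.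
    by rewrite mmap_chain_rule; apply: eq_bigr => k _; rewrite !mxE mulrC.
  have /matrixP/(_ l 0) : \det J *: v = 0.
    by rewrite -mul_scalar_mx -mul_adj_mx -mulmxA Jv mulmx0.
  by rewrite !mxE => /eqP; rewrite mulf_eq0 (negPf nzdet) => /eqP.
move: PF0; rewrite (mderiv_eq0_const ch0 dP) mmapC => /eqP.
by rewrite mpolyC_eq0 => /eqP ->.
Qed.

(** * The map from syzygy matrices to tangent maps *)

Lemma mpolyXU_neq0 (R : nzRingType) n (i : 'I_n) : 'X_i != 0 :> {mpoly R[n]}.
Proof. by rewrite -msupp_eq0 msuppX. Qed.

(** [edeg] on natural numbers, for rows listed by [iota] and for evaluation. *)
Definition edeg_nat (n d j : nat) : nat :=
  if (j < acnt n d)%N then addn d (qnd n d) else (addn d (qnd n d)).+1.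

Section Flatten.
Variables (n d : nat) (V : nmodType).

Definition flat_coefs (b : 'I_n -> nat -> V) : seq V :=
  flatten [seq [seq b j k | k <- iota 0 (edeg n d j).-1] | j <- enum 'I_n].

Lemma size_flat_coefs b : size (flat_coefs b) = homdim n d.
Proof.
rewrite size_flatten sumnE big_map big_map big_enum.
by apply: eq_bigr => j _; rewrite size_map size_iota.
Qed.

(** The blocks follow the order that [homoff] counts, so the flat list is the coordinate vector that
    [homOf] reads. *)
Lemma nth_flat_coefs b (j : 'I_n) k : (k < (edeg n d j).-1)%N ->
  (homoff n d j + k < homdim n d)%N /\ (flat_coefs b)`_(homoff n d j + k) = b j k.
Proof.
move=> ltk; pose g i := (edeg_nat n d i).-1.
have shE : shape [seq [seq b j k | k <- iota 0 (edeg n d j).-1] | j <- enum 'I_n] =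
    map g (iota 0 n).
  rewrite /shape -map_comp -(val_enum_ord n) -map_comp; apply: eq_map => i /=.
  by rewrite size_map size_iota.
have offE : (homoff n d j + k)%N = flatten_index (map g (iota 0 n)) j k.
  rewrite /flatten_index; congr (_ + _)%N.
  rewrite -map_take take_iota (minn_idPl (ltnW (ltn_ord j))) sumnE big_map /homoff.
  rewrite -[iota 0 j]/(iota 0 j) -{2}(subn0 j) -/(index_iota 0 j).
  by rewrite (big_nat_widen _ _ n) ?(ltnW (ltn_ord j)) // big_mkord.
have ltk' : (k < nth 0%N (map g (iota 0 n)) j)%N.
  by rewrite (nth_map 0%N) ?size_iota // nth_iota.
rewrite offE; split.
  have -> : homdim n d = sumn (map g (iota 0 n)).
    by rewrite -(size_flat_coefs b) size_flatten shE.
  exact: flatten_indexP.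
rewrite /flat_coefs nth_flatten shE flatten_indexKl // flatten_indexKr //.
by rewrite (nth_map j) ?size_enum_ord // nth_ord_enum (nth_map 0%N) ?size_iota // nth_iota.
Qed.

End Flatten.

Section TangentMap.
Variables (n d : nat).

Definition rowdeg (j : 'I_n) := (edeg n d j - d)%N.

(** Row, column and exponent of a coefficient. Exponents run over [0..q+1], which covers rows of
    degree [q] and of degree [q+1] in one product type. *)
Definition coord_index : finType := ('I_n * 'I_n.+1 * 'I_(qnd n d).+2)%type.

Section Ring.
Variables (R : comNzRingType) (mu : coord_index -> R).

(** Forms are dehomogenised at [t = 1]. The ring is arbitrary so that the same formulas serve
    generic coefficients and points. *)
Definition syz_entry (j : 'I_n) (i : 'I_n.+1) : {poly R} :=
  \poly_(k < (rowdeg j).+1) mu (j, i, inord k).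

Definition curve_coord (i : 'I_n.+1) : {poly R} :=
  (-1) ^+ i * \det (\matrix_(a, b) syz_entry a (lift i b)).

(** At [t = 1] the identity [sum_i M_ji dG_i/ds = t f_j] leaves [f_j] itself. *)
Definition tangent_comp (j : 'I_n) : {poly R} :=
  \sum_i syz_entry j i * (curve_coord i)^`().

Definition tangent_coefs : seq R :=
  flat_coefs d (fun j k => (tangent_comp j)`_k).

End Ring.
End TangentMap.

(* A dual number [(a, b)] over [Z] stands for [a + b eps], [eps ^ 2 = 0]. *)
Definition dual : Type := (Z * Z)%type.
Definition dual0 : dual := (0, 0)%BZ.
Definition dual_add (a b : dual) : dual := (a.1 + b.1, a.2 + b.2)%BZ.
Definition dual_mul (a b : dual) : dual := (a.1 * b.1, a.1 * b.2 + a.2 * b.1)%BZ.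
Definition dual_opp (a : dual) : dual := (- a.1, - a.2)%BZ.
Definition dual_scale (k : Z) (a : dual) : dual := (k * a.1, k * a.2)%BZ.
Definition dual_is0 (a : dual) : bool := if a is (Z0, Z0) then true else false.

Fixpoint seq_add (p q : seq dual) : seq dual :=
  match p, q with
  | [::], _ => q
  | _, [::] => p
  | a :: p', b :: q' => dual_add a b :: seq_add p' q'
  end.

(** The test skips a pass over [q] for each zero coefficient, frequent at the sparse points chosen
    below. *)
Fixpoint seq_mul (p q : seq dual) : seq dual :=
  if p is a :: p' then
    let r := dual0 :: seq_mul p' q in
    if dual_is0 a then r else seq_add [seq dual_mul a b | b <- q] r
  else [::].

Fixpoint seq_deriv_from (k : nat) (p : seq dual) : seq dual :=
  if p is a :: p' then dual_scale (Z.of_nat k) a :: seq_deriv_from k.+1 p' else [::].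

Definition seq_deriv (p : seq dual) : seq dual := seq_deriv_from 1 (behead p).

Definition seq_sum (n : nat) (f : nat -> seq dual) : seq dual :=
  foldr (fun k acc => seq_add (f k) acc) [::] (iota 0 n).

Definition seq_sign (k : nat) (p : seq dual) : seq dual :=
  if odd k then map dual_opp p else p.

Fixpoint seq_det (n : nat) (A : nat -> nat -> seq dual) : seq dual :=
  if n is n'.+1 then
    seq_sum n (fun k => let a := A 0 k in
      if all dual_is0 a then [::]
      else seq_sign k (seq_mul a (seq_det n' (fun i j => A i.+1 (bump k j)))))
  else [:: (1, 0)%BZ].

(** * Correctness of the arithmetic on lists of dual numbers *)

Section DualModel.
Variables (R : comNzRingType) (rel : R -> dual -> Prop).
Hypotheses (rel0 : rel 0 dual0) (rel1 : rel 1 (1, 0)%BZ)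
  (relD : forall x y a b, rel x a -> rel y b -> rel (x + y) (dual_add a b))
  (relN : forall x a, rel x a -> rel (- x) (dual_opp a))
  (relM : forall x y a b, rel x a -> rel y b -> rel (x * y) (dual_mul a b)).

(** Positions past the end of the list count as [dual0], so lengths need not match sizes. *)
Definition poly_rel (P : {poly R}) (p : seq dual) :=
  forall k, rel P`_k (nth dual0 p k).

Lemma nth_all_is0 p k : all dual_is0 p -> nth dual0 p k = dual0.
Proof.
have [lt|le] := ltnP k (size p); last by rewrite nth_default.
by move=> /(all_nthP dual0)/(_ k lt); case: (nth _ _ _) => [[|?|?] [|?|?]].
Qed.

Lemma poly_rel0 : poly_rel 0 [::].
Proof. by move=> k; rewrite coef0 nth_nil. Qed.

Lemma nth_seq_add p q k :
  nth dual0 (seq_add p q) k = dual_add (nth dual0 p k) (nth dual0 q k).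
Proof.
have add0 a : dual_add dual0 a = a by case: a.
have addr0 a : dual_add a dual0 = a by case: a => a b; rewrite /dual_add /= !Z.add_0_r.
by elim: p q k => [|a p IH] [|b q] [|k] //=; rewrite ?nth_nil ?add0 ?addr0.
Qed.

Lemma seq_add_rel P Q p q : poly_rel P p -> poly_rel Q q -> poly_rel (P + Q) (seq_add p q).
Proof. by move=> Pp Qq k; rewrite coefD nth_seq_add; apply: relD. Qed.

Lemma seq_map_rel (h P : {poly R}) f g p : f dual0 = dual0 ->
  (forall x a, rel x a -> rel (g x) (f a)) ->
  (forall k, h`_k = g P`_k) -> poly_rel P p -> poly_rel h (map f p).
Proof.
move=> f0 fg hE Pp k; rewrite hE.
have -> : nth dual0 (map f p) k = f (nth dual0 p k).
  have [lt|le] := ltnP k (size p); first by rewrite (nth_map dual0).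
  by rewrite !nth_default ?size_map.
exact: fg.
Qed.

Lemma seq_mul_rel P Q p q : poly_rel P p -> poly_rel Q q -> poly_rel (P * Q) (seq_mul p q).
Proof.
move=> + Qq; elim: p P => [|a p IH] P Pp /=.
  (* The coefficients of [P] are only related to [dual0], which does not make them zero, so each
     term of the product goes through [relM]. *)
  suff rP0 : forall k, rel (P * Q)`_k dual0 by move=> k; rewrite nth_nil.
  move=> k; rewrite coefM; elim/big_ind: _ => // [x y rx ry|i _].
    exact: (relD rx ry).
  by have := relM (Pp i) (Qq (k - i)%N); rewrite nth_nil.
pose P' := \poly_(i < size P) P`_i.+1.
have P'E i : P'`_i = P`_i.+1.
  by rewrite coef_poly; case: ltnP => // le; rewrite nth_default // leqW.
have PE : P = (P`_0)%:P + P' * 'X.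
  by apply/polyP=> -[|i]; rewrite coefD coefC coefMX ?addr0 //= add0r P'E.
have tail : poly_rel (P' * Q * 'X) (dual0 :: seq_mul p q).
  have := IH P' (fun i => _); rewrite /poly_rel => IHk [|k]; rewrite coefMX //=.
  by apply: IHk => i; rewrite P'E; apply: (Pp i.+1).
move=> k; have -> : (P * Q)`_k = P`_0 * Q`_k + (P' * Q * 'X)`_k.
  by rewrite {1}PE mulrDl -[P' * 'X * Q]mulrA ['X * Q]mulrC mulrA coefD coefCM.
have := relD (relM (Pp 0%N) (Qq k)) (tail k).
have add0 c : dual_add dual0 c = c by case: c.
rewrite [nth _ (a :: p) 0]/=; case: ifP => [a0|_].
  suff -> : dual_mul a (nth dual0 q k) = dual0 by rewrite add0.
  by case: a a0 {Pp} => [[|?|?] [|?|?]].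
rewrite nth_seq_add; have [lt|le] := ltnP k (size q); first by rewrite (nth_map dual0).
have mul0 : dual_mul a dual0 = dual0 by rewrite /dual_mul /= !Z.mul_0_r.
by rewrite (nth_default _ le) mul0 [nth _ (map _ _) _]nth_default ?size_map.
Qed.

Lemma scale_rel x a k : rel x a -> rel (x *+ k) (dual_scale (Z.of_nat k) a).
Proof.
move=> xa; elim: k => [|k IH]; first by rewrite mulr0n.
have -> : dual_scale (Z.of_nat k.+1) a = dual_add a (dual_scale (Z.of_nat k) a).
  by rewrite /dual_add /dual_scale Nat2Z.inj_succ !Z.mul_succ_l; congr (_, _); apply: Z.add_comm.
by rewrite mulrS; apply: relD.
Qed.

Lemma seq_deriv_rel P p : poly_rel P p -> poly_rel P^`() (seq_deriv p).
Proof.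
move=> Pp k; rewrite coef_deriv; have := @scale_rel _ _ k.+1 (Pp k.+1).
suff -> : nth dual0 (seq_deriv p) k =
  dual_scale (Z.of_nat k.+1) (nth dual0 p k.+1) by [].
have aux m (r : seq dual) : nth dual0 (seq_deriv_from m r) k =
    dual_scale (Z.of_nat (m + k)) (nth dual0 r k).
  elim: r m k => [|a r IH] m [|k'] //=; rewrite ?addn0 //.
  - by rewrite /dual_scale /= Z.mul_0_r.
  - by rewrite /dual_scale /= Z.mul_0_r.
  - by rewrite IH addSnnS.
by rewrite /seq_deriv aux add1n; case: p {Pp} => [|b p] //=; rewrite nth_nil.
Qed.

Lemma seq_sign_rel P p k : poly_rel P p -> poly_rel ((-1) ^+ k * P) (seq_sign k p).
Proof.
move=> Pp; rewrite /seq_sign -signr_odd; case: (odd k); last by rewrite mul1r.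
rewrite mulN1r; apply: (@seq_map_rel _ P dual_opp -%R) Pp => //.
by move=> i; apply: coefN.
Qed.

Lemma seq_sum_rel n (F : 'I_n -> {poly R}) (f : nat -> seq dual) :
  (forall k : 'I_n, poly_rel (F k) (f k)) -> poly_rel (\sum_k F k) (seq_sum n f).
Proof.
move=> Ff; rewrite /seq_sum -val_enum_ord -big_enum.
elim: (enum 'I_n) => [|k s IH] /=; first by rewrite big_nil; apply: poly_rel0.
by rewrite big_cons; apply: seq_add_rel.
Qed.

Lemma seq_det_rel n (A : 'M[{poly R}]_n) (a : nat -> nat -> seq dual) :
  (forall i j, poly_rel (A i j) (a i j)) -> poly_rel (\det A) (seq_det n a).
Proof.
elim: n A a => [|n IH] A a Aa.
  by rewrite det_mx00 => -[|k] /=; rewrite coef1 ?nth_nil //.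
rewrite (expand_det_row _ ord0); apply: seq_sum_rel => k /=.
case: ifP => [a0|_].
  (* A skipped entry is also represented by [[::]], and [seq_mul [::] _] is [[::]], so the skipped
     term agrees with the general one. *)
  have A0 : poly_rel (A ord0 k) [::].
    by move=> i; have := Aa ord0 k i; rewrite nth_all_is0 // nth_nil.
  have IHk : poly_rel (cofactor A ord0 k) (seq_sign k (seq_det n (fun i j => a i.+1 (bump k j)))).
    apply: seq_sign_rel; apply: IH => i j; rewrite !mxE; exact: Aa.
  exact: (seq_mul_rel A0 IHk).
rewrite /cofactor mulrCA; apply: seq_sign_rel; apply: seq_mul_rel; first exact: Aa.
by apply: IH => i j; rewrite !mxE; apply: Aa.
Qed.

End DualModel.

(** One row of the Jacobian matrix at [x0]: the coefficient [(j0, i0, k0)] is perturbed by [eps],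
    and the second components of the result are the partial derivatives in that direction. *)
Definition tangent_row (n d : nat) (x0 : nat -> nat -> nat -> Z) (j0 i0 k0 : nat) : seq Z :=
  let Ml := [seq [seq [seq (x0 j i k, if [&& j == j0, i == i0 & k == k0] then 1%BZ else 0%BZ)
              | k <- iota 0 (edeg_nat n d j - d).+1] | i <- iota 0 n.+1] | j <- iota 0 n] in
  let M j i := nth [::] (nth [::] Ml j) i in
  let dG := [seq seq_deriv (seq_sign i (seq_det n (fun a b => M a (bump i b))))
              | i <- iota 0 n.+1] in
  flatten [seq (let A := seq_sum n.+1 (fun i => seq_mul (M j i) (nth [::] dG i)) in
           [seq (nth dual0 A k).2 | k <- iota 0 (edeg_nat n d j).-1]) | j <- iota 0 n].

(* The action of [SL_(n+1)] on syzygy matrices leaves [f] unchanged, so the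
   directions [k = 0] may be omitted without losing rank. *)
Definition tangent_rows (n d : nat) (x0 : nat -> nat -> nat -> Z) : seq (seq Z) :=
  flatten [seq flatten [seq [seq tangent_row n d x0 j i k | k <- iota 1 (edeg_nat n d j - d)]
    | i <- iota 0 n.+1] | j <- iota 0 n].

(** * Gaussian elimination modulo a prime *)

Fixpoint eliminate_row (p x y : Z) (piv r : seq Z) : seq Z :=
  match piv, r with
  | a :: piv', b :: r' => ((x * b - y * a) mod p)%BZ :: eliminate_row p x y piv' r'
  | _, _ => [::]
  end.

(** Rows are cross-multiplied with the pivot row, so no inverse modulo [p] is computed. The pivot
    row stays in the list, where it becomes zero. *)
Fixpoint full_rank_mod (p : Z) (N : nat) (rows : seq (seq Z)) : bool :=
  if N is N'.+1 then
    if [seq r <- rows | ~~ Z.eqb (head 0%BZ r mod p) 0%BZ] is piv :: _ then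
      full_rank_mod p N' [seq (if Z.eqb (head 0%BZ r) 0%BZ then behead r
        else eliminate_row p (head 0%BZ piv) (head 0%BZ r) (behead piv) (behead r)) | r <- rows]
    else false
  else true.

Section Elimination.
Variables (F : fieldType) (phi : {rmorphism Z -> F}) (p : Z).
Hypothesis phi_mod : forall x, phi (x mod p)%BZ = phi x.
Hypothesis phi_eq0 : forall x, phi x = 0 -> (x mod p = 0)%BZ.

(* Rows have a common length, so truncating to the shorter one is harmless. *)
Lemma nth_eliminate_row x y piv r k : size piv = size r ->
  phi (nth 0%BZ (eliminate_row p x y piv r) k) =
  phi x * phi (nth 0%BZ r k) - phi y * phi (nth 0%BZ piv k).
Proof.
elim: piv r k => [|a piv IH] [|b r] [|k] //= => [_|_|_|[/IH //]].
- by rewrite rmorph0 !mulr0 subr0.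
- by rewrite rmorph0 !mulr0 subr0.
- by rewrite phi_mod -!rmorphM -rmorphB.
Qed.

Lemma size_eliminate_row x y piv r : size piv = size r ->
  size (eliminate_row p x y piv r) = size r.
Proof. by elim: piv r => [|a piv IH] [|b r] //= [/IH ->]. Qed.

(** Full column rank is expressed by a trivial kernel. Eliminated rows are combinations of the old
    ones, so they annihilate the tail of [u], which is zero by induction; the pivot row then forces
    [u 0 = 0]. *)
Lemma full_rank_modP N rows (u : nat -> F) : full_rank_mod p N rows ->
  (forall r, r \in rows -> size r = N) ->
  (forall r, r \in rows -> \sum_(k < N) u k * phi (nth 0%BZ r k) = 0) ->
  forall k, (k < N)%N -> u k = 0.
Proof.
elim: N rows u => // N IH rows u /=.
case E : [seq _ <- _ | _] => [//|piv s] full sz orth.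
have : piv \in [seq r <- rows | ~~ Z.eqb (head 0%BZ r mod p) 0%BZ] by rewrite E mem_head.
rewrite mem_filter => /andP[nzp piv_in].
have headE r : r \in rows -> exists y t, r = y :: t /\ size t = N.
  by move=> /sz; case: r => //= y t [<-]; exists y, t.
have [x [t [pivE szt]]] := headE _ piv_in.
have nzx : phi x != 0.
  by apply: contraNneq nzp => /phi_eq0; rewrite pivE /= => ->.
have tail0 : forall k, (k < N)%N -> u k.+1 = 0.
  apply: (IH _ (fun k => u k.+1) full) => _ /mapP[r r_in ->].
    have [y [q [rE szq]]] := headE _ r_in; rewrite rE pivE /=; case: ifP => // _.
    by rewrite size_eliminate_row // szt.
  have [y [q [rE szq]]] := headE _ r_in; rewrite rE pivE /=.
  case: ifP => [/Z.eqb_eq y0|_].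
    by have := orth _ r_in; rewrite rE big_ord_recl /= y0 rmorph0 mulr0 add0r.
  have := orth _ r_in; have := orth _ piv_in.
  rewrite pivE rE !big_ord_recl /= => op oq.
  under eq_bigr => k _ do rewrite nth_eliminate_row ?szt // mulrBr !mulrA
    ![u _ * phi _]mulrC -!mulrA.
  rewrite sumrB -!mulr_sumr (canRL (addKr _) op) (canRL (addKr _) oq) !addr0.
  by rewrite !mulrN opprK mulrCA addrC [phi y * _]mulrCA [phi y * _]mulrC subrr.
case=> [_|k]; last exact: tail0.
have := orth _ piv_in; rewrite pivE big_ord_recl big1 => [|k _]; last first.
  by rewrite tail0 ?mul0r.
by rewrite addr0 => /eqP; rewrite mulf_eq0 (negPf nzx) orbF => /eqP.
Qed.

End Elimination.

(** * The Jacobian matrix at an integer point *)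

Section FullRank.
Variables (K : fieldType) (n d : nat) (x0 : nat -> nat -> nat -> Z).
Hypothesis ch0 : [pchar K] =i pred0.
Notation T := (coord_index n d).
Notation m := #|T|.

Definition Z_to (R : nzRingType) (z : Z) : R := (int_of_Z z)%:~R.

Definition gen_coord (t : T) : {mpoly K[m]} := 'X_(enum_rank t).

Definition point_eval (a : 'I_m) : K :=
  let: (j, i, k) := enum_val a in Z_to K (x0 j i k).

(** The relation fed to the dual model: evaluation at the point displaced by [eps] in direction
    [t]. *)
Definition dual_at (t : 'I_m) (P : {mpoly K[m]}) (a : dual) : Prop :=
  meval point_eval P = Z_to K a.1 /\ meval point_eval P^`M(t) = Z_to K a.2.

Lemma Z_toD (R : nzRingType) a b : Z_to R (a + b)%BZ = Z_to R a + Z_to R b.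
Proof. by rewrite /Z_to -rmorphD -(rmorphD int_of_Z). Qed.

Lemma Z_toN (R : nzRingType) a : Z_to R (- a)%BZ = - Z_to R a.
Proof. by rewrite /Z_to -rmorphN -(rmorphN int_of_Z). Qed.

Lemma Z_toM (R : nzRingType) a b : Z_to R (a * b)%BZ = Z_to R a * Z_to R b.
Proof. by rewrite /Z_to -rmorphM -(rmorphM int_of_Z). Qed.

Lemma Z_to_nat (R : nzRingType) k : Z_to R (Z.of_nat k) = k%:R.
Proof. by rewrite /Z_to (Z_of_intK (Posz k)). Qed.

Lemma Z_to_eq0 z : Z_to K z = 0 -> z = 0.
Proof.
have /pcharf0P ch := ch0; rewrite -[z]int_of_ZK /Z_to Z_of_intK.
case: (int_of_Z z) => k /eqP; first by rewrite ch => /eqP ->.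
by rewrite NegzE rmorphN oppr_eq0 /= ch.
Qed.

Lemma tangent_row_deriv (t0 : T) :
  [seq meval point_eval P^`M(enum_rank t0) | P <- tangent_coefs gen_coord] =
  [seq Z_to K z | z <- let: (j0, i0, k0) := t0 in tangent_row n d x0 j0 i0 k0].
Proof.
case: t0 => -[j0 i0] k0; set t := enum_rank _.
have rel0 : dual_at t 0 dual0 by rewrite /dual_at mderiv0 meval0.
have rel1 : dual_at t 1 (1, 0)%BZ.
  by rewrite /dual_at -mpolyC1 mderivC meval0 mevalC.
have relD x y a b : dual_at t x a -> dual_at t y b -> dual_at t (x + y) (dual_add a b).
  by move=> [x1 x2] [y1 y2]; rewrite /dual_at mderivD !mevalD x1 x2 y1 y2 !Z_toD.
have relN x a : dual_at t x a -> dual_at t (- x) (dual_opp a).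
  by move=> [x1 x2]; rewrite /dual_at mderivN !mevalN x1 x2 !Z_toN.
have relM x y a b : dual_at t x a -> dual_at t y b -> dual_at t (x * y) (dual_mul a b).
  move=> [x1 x2] [y1 y2]; rewrite /dual_at mderivM mevalD !mevalM x1 x2 y1 y2.
  by rewrite Z_toD !Z_toM addrC.
rewrite /tangent_row /tangent_coefs /flat_coefs -(val_enum_ord n).
set Ml := [seq [seq [seq _ | k <- _] | i <- _] | j <- _].
set M := fun j i => nth [::] (nth [::] Ml j) i.
set dG := [seq seq_deriv _ | i <- _].
rewrite !map_flatten -!map_comp; congr flatten; apply: eq_map => j /=.
rewrite -!map_comp; apply: eq_map => k /=.
have relM_entry (j' : 'I_n) (i : 'I_n.+1) :
    poly_rel (dual_at t) (syz_entry gen_coord j' i) (M j' i).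
  have -> : M j' i =
      [seq (x0 j' i k', if [&& j' == j0, i == i0 & k' == k0 :> nat] then 1%BZ else 0%BZ)
              | k' <- iota 0 (rowdeg d j').+1].
    rewrite /M /Ml val_enum_ord (nth_map 0%N) ?size_iota // nth_iota // add0n.
    by rewrite (nth_map 0%N) ?size_iota // nth_iota.
  move=> k'; rewrite coef_poly; case: ifP => [lt|ge]; last first.
    by rewrite nth_default // size_map size_iota leqNgt ge.
  rewrite (nth_map 0%N) ?size_iota // nth_iota // add0n.
  (* Row degrees are at most [q+1], so [inord] loses no exponent. *)
  have kq : (k' < (qnd n d).+2)%N.
    apply: leq_trans lt _; rewrite /rowdeg /edeg ltnS.
    by case: ifP => _; lia.
  rewrite /dual_at /= /gen_coord mevalXU /point_eval enum_rankK inordK //; split=> //.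
  rewrite mderivX mnm1E (inj_eq enum_rank_inj) /=.
  have -> : ((j', i, inord k') == (j0, i0, k0)) = [&& j' == j0, i == i0 & k' == k0 :> nat].
    by rewrite !xpair_eqE -andbA -(inj_eq val_inj (inord k')) /= inordK.
  case: ifP => [/and3P[/eqP ej /eqP ei /eqP ek]|_]; last by rewrite scale0r meval0.
  have -> : enum_rank (j', i, inord k' : 'I_(qnd n d).+2) = t.
    by rewrite /t ej ei; congr (enum_rank (_, _, _)); apply: val_inj; rewrite /= inordK.
  have -> : (U_(t) - U_(t) = 0)%MM by apply/mnmP=> a; rewrite mnmBE mnm0E subnn.
  by rewrite scale1r mpolyX0 meval1.
have relA : poly_rel (dual_at t) (tangent_comp gen_coord j)
    (seq_sum n.+1 (fun i => seq_mul (M j i) (nth [::] dG i))).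
  apply: seq_sum_rel => // i; apply: seq_mul_rel => //.
  rewrite /dG (nth_map 0%N) ?size_iota // nth_iota // add0n.
  apply: seq_deriv_rel => //; apply: seq_sign_rel => //; apply: seq_det_rel => // a b.
  by rewrite mxE.
by case: (relA k).
Qed.

Lemma size_tangent_coefs (R : comNzRingType) (mu : T -> R) :
  size (tangent_coefs mu) = homdim n d.
Proof. exact: size_flat_coefs. Qed.

(** Full column rank modulo [p] gives a maximal minor of the integer Jacobian matrix that is nonzero
    modulo [p], hence nonzero in [Z] and in [K]. *)
Lemma tangent_map_dominant (p : nat) : prime p ->
  full_rank_mod (Z.of_nat p) (homdim n d) (tangent_rows n d x0) ->
  exists f : 'I_(homdim n d) -> 'I_m,
    \det (\matrix_(a, l < homdim n d) ((tangent_coefs gen_coord)`_l)^`M(f a)) != 0.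
Proof.
move=> pp full; set N := homdim n d in full *.
pose drow (a : 'I_m) := let: (j, i, k) := enum_val a in tangent_row n d x0 j i k.
pose phi : {rmorphism Z -> 'F_p} := (intr \o int_of_Z)%FUN.
pose A := \matrix_(a < m, l < N) nth 0%BZ (drow a) l.
have row_out r : r \in tangent_rows n d x0 -> exists a, r = drow a.
  rewrite /tangent_rows => /flatten_mapP[j]; rewrite mem_iota leq0n add0n andTb => jn.
  move=> /flatten_mapP[i]; rewrite mem_iota leq0n add0n andTb => ile.
  move=> /mapP[k]; rewrite mem_iota => k_in ->.
  have kq : (k < (qnd n d).+2)%N by move: k_in; rewrite /edeg_nat; case: ifP => _; lia.
  by exists (enum_rank (Ordinal jn, Ordinal ile, Ordinal kq)); rewrite /drow enum_rankK.
have size_drow a : size (drow a) = N.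
  have := congr1 size (tangent_row_deriv (enum_val a)); rewrite !size_map size_tangent_coefs.
  by rewrite /drow; case: (enum_val a) => -[j i] k.
(* A vector in the kernel of the transpose is orthogonal to every computed row, so elimination
   forces it to be zero. *)
have fullA : row_full (map_mx phi A).
  rewrite /row_full -mxrank_tr -/(row_free _) -kermx_eq0; apply/eqP/row_matrixP => i.
  set w := row _ _; have wA : w *m (map_mx phi A)^T = 0.
    by rewrite /w -row_mul mulmx_ker row0.
  pose u k := if insub k : option 'I_N is Some l then w 0 l else 0.
  rewrite row0; apply/rowP => l; rewrite [RHS]mxE.
  have -> : w 0 l = u l by rewrite /u valK.
  apply: (full_rank_modP (phi := phi) _ _ full) => //.
  - move=> x; rewrite {2}(Z.div_mod x (Z.of_nat p)); last by case: (p) pp.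
    by rewrite [RHS]Z_toD Z_toM Z_to_nat pchar_Fp_0 // mul0r add0r.
  - move=> x /eqP; rewrite -(dvdz_pcharf (pchar_Fp pp)) => /dvdzP[q qE].
    by rewrite -[x]int_of_ZK qE rmorphM; apply: Z_mod_mult.
  - by move=> r /row_out [a ->].
  move=> r /row_out [a ->].
  have := congr1 (fun B : 'rV__ => B 0 a) wA; rewrite !mxE => e; rewrite -[RHS]e.
  by apply: eq_bigr => k _; rewrite /u valK !mxE.
exists (fullrankfun fullA); set f := fullrankfun fullA.
have := fullrowsub_unit fullA; rewrite -/f -map_mxsub unitmxE det_map_mx unitfE => nzdet.
have {nzdet}nzK : Z_to K (\det (rowsub f A)) != 0.
  by apply: contraNneq nzdet => /Z_to_eq0 ->; rewrite rmorph0.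
set J := \matrix_(_, _) _; apply: contraNneq nzK => J0.
pose psi : {rmorphism Z -> K} := (intr \o int_of_Z)%FUN.
(* The symbolic minor specialises at the point to the integer minor, so it cannot vanish. *)
have evJ : map_mx (meval point_eval) J = map_mx psi (rowsub f A).
  apply/matrixP => a l; rewrite !mxE /drow.
  have := congr1 (nth 0 ^~ l) (tangent_row_deriv (enum_val (f a))).
  rewrite enum_valK (nth_map 0) ?size_tangent_coefs // => ->.
  move: (size_drow (f a)); rewrite /drow; case: (enum_val _) => -[j i] k sz.
  by rewrite (nth_map 0%BZ) ?sz.
by rewrite -[Z_to K _]/(psi _) -det_map_mx -evJ det_map_mx J0 rmorph0.
Qed.

End FullRank.

(** * Binary forms and realization *)

Section BinaryForms.
Variable L : fieldType.
Implicit Types (P Q : {mpoly L[2]}) (p q : {poly L}).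
Notation s := (ord0 : 'I_2).
Notation t := (ord_max : 'I_2).

Definition dehom : {mpoly L[2]} -> {poly L} :=
  mmap (@polyC L) (fun i => if i == s then 'X else 1).

HB.instance Definition _ := GRing.RMorphism.on dehom.

Definition homogenize (k : nat) p : {mpoly L[2]} :=
  \sum_(i < k.+1) p`_i *: (vs ^+ i * vt ^+ (k - i)).

Lemma mdeg2 (m : 'X_{1..2}) : mdeg m = (m s + m t)%N.
Proof. by rewrite mdegE big_ord_recl big_ord1; congr (_ + m _)%N; apply: val_inj. Qed.

Lemma dehom_vs : dehom vs = 'X. Proof. by rewrite /dehom mmapX mmap1U eqxx. Qed.
Lemma dehom_vt : dehom vt = 1. Proof. by rewrite /dehom mmapX mmap1U. Qed.

Lemma dehomD P Q : dehom (P + Q) = dehom P + dehom Q.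
Proof. exact: rmorphD. Qed.

Lemma dehomM P Q : dehom (P * Q) = dehom P * dehom Q.
Proof. exact: rmorphM. Qed.

Lemma dehomZ a P : dehom (a *: P) = a *: dehom P.
Proof. by rewrite /dehom mmapZ mul_polyC. Qed.

Lemma mpolyX2 (m : 'X_{1..2}) : 'X_[m] = vs ^+ m s * vt ^+ m t :> {mpoly L[2]}.
Proof.
rewrite mpolyXE_id big_ord_recl big_ord1; congr (_ * 'X__ ^+ m _); exact: val_inj.
Qed.

Lemma dehom_monomial i j : dehom (vs ^+ i * vt ^+ j) = 'X^i.
Proof. by rewrite rmorphM !rmorphXn /= dehom_vs dehom_vt expr1n mulr1. Qed.

Lemma dehom_homogenize k p : (size p <= k.+1)%N -> dehom (homogenize k p) = p.
Proof.
move=> szp; rewrite /homogenize rmorph_sum /=.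
under eq_bigr => i _ do rewrite dehomZ dehom_monomial.
by rewrite -poly_def -/(take_poly k.+1 p) take_poly_id.
Qed.

Lemma homogenize_is_homog k p : homogenize k p \is k.-homog.
Proof.
apply: rpred_sum => i _; apply: rpredZ.
have le_ik : (i <= k)%N by rewrite -ltnS.
have hv (j : 'I_2) e : ('X_j : {mpoly L[2]}) ^+ e \is e.-homog.
  by have := @dhomogMn _ _ mdeg 1 'X_j e; rewrite mul1n; apply; rewrite dhomogX /= mdeg1.
by have := dhomogM (hv s i) (hv t (k - i)%N); rewrite subnKC.
Qed.

(** A form of known degree is determined by its restriction to [t = 1]; this carries univariate
    computations back to forms. *)
Lemma homogenizeK k P : P \is k.-homog -> homogenize k (dehom P) = P.
Proof.
move=> homP; rewrite {1}(mpolyE P) [in RHS](mpolyE P) rmorph_sum /homogenize /=.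
under eq_bigr => i _ do rewrite coef_sum scaler_suml.
rewrite exchange_big /=; apply: eq_big_seq => m /(dhomog_mf homP) /=; rewrite mdeg2 => mk.
have lt_m : (m s < k.+1)%N by rewrite -mk ltnS leq_addr.
rewrite mpolyX2 dehomZ dehom_monomial (bigD1 (Ordinal lt_m)) //= coefZ coefXn eqxx mulr1.
rewrite big1 ?addr0; last first.
  by move=> i /negPf ne; rewrite coefZ coefXn -[_ == _ :> nat]/(i == Ordinal lt_m) ne mulr0 scale0r.
by rewrite -mk addKn.
Qed.

Lemma size_dehom k P : P \is k.-homog -> (size (dehom P) <= k.+1)%N.
Proof.
move=> homP; apply/leq_sizeP => j lt_kj.
rewrite (mpolyE P) rmorph_sum coef_sum /= big_seq big1 // => m /(dhomog_mf homP) /=.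
rewrite mdeg2 => mk; rewrite dehomZ mpolyX2 dehom_monomial coefZ coefXn.
by rewrite gtn_eqF ?mulr0 // (leq_trans _ lt_kj) // ltnS -mk leq_addr.
Qed.

Lemma dehom_mderiv P : dehom P^`M(s) = (dehom P)^`().
Proof.
elim/mpoly_ring_ind: P => [c|i|P Q IHP IHQ|P Q IHP IHQ].
- by rewrite mderivC rmorph0 /dehom mmapC derivC.
- rewrite mderivX mnm1E; have [->|ne] := eqVneq i s.
    have -> : (U_(s) - U_(s) = 0 :> 'X_{1..2})%MM.
      by apply/mnmP=> a; rewrite mnmBE mnm0E subnn.
    by rewrite scale1r mpolyX0 rmorph1 -/vs dehom_vs derivX.
  by rewrite scale0r rmorph0 /dehom mmapX mmap1U (negPf ne) derivC.
- by rewrite mderivD !dehomD derivD IHP IHQ.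
- by rewrite mderivM dehomD !dehomM derivM IHP IHQ.
Qed.

Lemma euler_homog k P : P \is k.-homog -> vs * P^`M(s) + vt * P^`M(t) = k%:R *: P.
Proof.
move=> homP; have XdX (i : 'I_2) (m : 'X_{1..2}) :
    'X_i * ('X_[m])^`M(i) = (m i)%:R *: 'X_[m] :> {mpoly L[2]}.
  rewrite mderivX -scalerAr; have [->|nz] := eqVneq (m i) 0%N; first by rewrite !scale0r.
  by rewrite -mpolyXD addmC submK // lep1mP.
transitivity (\sum_(m <- msupp P) P@_m *: (k%:R *: 'X_[m] : {mpoly L[2]})); last first.
  rewrite [in RHS](mpolyE P) scaler_sumr; apply: eq_bigr => m _.
  by rewrite !scalerA mulrC.
rewrite [in LHS](mpolyE P) !raddf_sum /= !mulr_sumr -big_split /=.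
apply: eq_big_seq => m /(dhomog_mf homP) /=; rewrite mdeg2 => mk.
by rewrite !mderivZ -!scalerAr !XdX -scalerDr -scalerDl -natrD mk.
Qed.

Lemma mderiv_homog k P i : P \is k.+1.-homog -> P^`M(i) \is k.-homog.
Proof.
move=> homP; apply/dhomogP => m; rewrite mcoeff_msupp mcoeff_mderiv => nz.
have : (m + U_(i))%MM \in msupp P.
  by rewrite mcoeff_msupp; apply: contraNneq nz => ->; rewrite mul0rn.
by move/(dhomog_mf homP) => /=; rewrite mdegD mdeg1 addn1 => -[].
Qed.

Lemma dhomog_bigprod (I : Type) (r : seq I) (e : I -> nat) (F : I -> {mpoly L[2]}) :
  (forall i, F i \is (e i).-homog) -> \prod_(i <- r) F i \is (\sum_(i <- r) e i)%N.-homog.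
Proof.
move=> hF; elim: r => [|i r IH]; first by rewrite !big_nil dhomog1.
by rewrite !big_cons; apply: dhomogM.
Qed.

End BinaryForms.

Lemma edegE n d (j : 'I_n) : edeg n d j = (d + rowdeg d j)%N.
Proof. by rewrite /rowdeg subnKC // /edeg; case: ifP => _; lia. Qed.

(** There are [a] rows of degree [q] and [n - a] of degree [q+1], with [a = (q+1)n - d]. The sum is
    the degree of the maximal minors, that is, of the curve. *)
Lemma sum_rowdeg n d : (0 < n)%N -> (\sum_(j < n) rowdeg d j)%N = d.
Proof.
move=> n0; have rE (j : 'I_n) : rowdeg d j = (qnd n d + ~~ (j < acnt n d))%N.
  by rewrite /rowdeg /edeg; case: ltnP => _ /=; lia.
under eq_bigr => j _ do rewrite rE.
rewrite big_split /= sum_nat_const card_ord.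
have -> : (\sum_(j < n) ~~ (j < acnt n d) = n - acnt n d)%N.
  rewrite -(big_mkord predT (fun j => nat_of_bool (~~ (j < acnt n d)%N))).
  have aN : (acnt n d <= n)%N by rewrite /acnt /qnd; have := divn_eq d n; nia.
  rewrite (big_cat_nat (n := acnt n d)) //= big_nat_cond big1 ?add0n; last first.
    by move=> i /andP[/andP[_ ->]].
  rewrite big_nat_cond (eq_bigr (fun=> 1%N)); last first.
    by move=> i /andP[/andP[le _] _]; rewrite ltnNge le.
  by rewrite -big_nat_cond sum_nat_const_nat muln1.
by rewrite /acnt /qnd; have := divn_eq d n; have := ltn_pmod d n0; nia.
Qed.

Lemma coordAt_flat (L : fieldType) n d (b : 'I_n -> nat -> L) (c : 'I_(homdim n d) -> L)
    (j : 'I_n) k :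
  (forall l : 'I_(homdim n d), (flat_coefs d b)`_l = c l) -> (k < (edeg n d j).-1)%N ->
  coordAt c (homoff n d j + k) = b j k.
Proof.
move=> cE ltk; have [lt bE] := nth_flat_coefs b ltk.
by rewrite /coordAt insubT -cE.
Qed.

(** * The curve given by the maximal minors, and its tangent map *)

Section Realization.
Variables (L : fieldType) (n d : nat) (mu : coord_index n d -> L).
Hypotheses (n_gt0 : (0 < n)%N) (d_gt0 : (0 < d)%N).
Notation s := (ord0 : 'I_2).
Notation t := (ord_max : 'I_2).

Definition syz_form (j : 'I_n) (i : 'I_n.+1) : {mpoly L[2]} :=
  homogenize (rowdeg d j) (syz_entry mu j i).

Definition curve_form (i : 'I_n.+1) : {mpoly L[2]} :=
  (-1) ^+ i * \det (\matrix_(a, b) syz_form a (lift i b)).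

Lemma syz_form_homog j i : syz_form j i \is (edeg n d j - d)%N.-homog.
Proof. exact: homogenize_is_homog. Qed.

Lemma curve_form_homog i : curve_form i \is d.-homog.
Proof.
rewrite /curve_form rpredMsign; apply: rpred_sum => f _; rewrite rpredMsign.
suff : \prod_a (\matrix_(a, b) syz_form a (lift i b)) a (f a) \is
    (\sum_(j < n) rowdeg d j)%N.-homog by rewrite sum_rowdeg.
by apply: dhomog_bigprod => a; rewrite mxE; apply: syz_form_homog.
Qed.

(* Expansion of a determinant with a repeated row. *)
Lemma syz_curve j : \sum_i syz_form j i * curve_form i = 0.
Proof.
pose B := \matrix_(a, i) (if unlift ord0 a is Some a' then syz_form a' i else syz_form j i)
  : 'M[{mpoly L[2]}]_n.+1.
have B0 : \det B = 0.
  apply: (@determinant_alternate _ _ _ ord0 (lift ord0 j)); first exact: neq_lift.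
  by move=> i; rewrite !mxE liftK unlift_none.
transitivity (\det B) => //; rewrite (expand_det_row _ ord0); apply: eq_bigr => i _.
rewrite mxE unlift_none /cofactor; congr (_ * (_ * \det _)).
by apply/matrixP=> a b; rewrite !mxE liftK.
Qed.

Lemma dehom_syz j i : dehom (syz_form j i) = syz_entry mu j i.
Proof. by apply: dehom_homogenize; apply: size_poly. Qed.

Lemma dehom_curve i : dehom (curve_form i) = curve_coord mu i.
Proof.
rewrite dehomM rmorph_sign -det_map_mx; congr (_ * \det _).
by apply/matrixP=> a b; rewrite !mxE /= dehom_syz.
Qed.

Definition tangent_form (i : 'I_2) (j : 'I_n) : {mpoly L[2]} :=
  \sum_a syz_form j a * (curve_form a)^`M(i).

Lemma tangent_form_homog i j : tangent_form i j \is (edeg n d j).-1.-homog.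
Proof.
have -> : (edeg n d j).-1 = ((edeg n d j - d) + d.-1)%N.
  by rewrite edegE; case: (d) d_gt0 => // d' _; lia.
apply: rpred_sum => a _; apply: dhomogM; first exact: syz_form_homog.
by apply: mderiv_homog; rewrite prednK // curve_form_homog.
Qed.

(** By Euler's identity the left side is [d] times the [j]-th entry of [M G]. *)
Lemma tangent_form_euler j : vs * tangent_form s j + vt * tangent_form t j = 0.
Proof.
transitivity (d%:R *: \sum_i syz_form j i * curve_form i).
  rewrite !mulr_sumr -big_split scaler_sumr /=; apply: eq_bigr => a _.
  by rewrite mulrCA [vt * _]mulrCA -mulrDr (euler_homog (curve_form_homog a)) -scalerAr.
by rewrite syz_curve scaler0.
Qed.

Lemma dehom_tangent j : dehom (tangent_form s j) = tangent_comp mu j.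
Proof.
rewrite rmorph_sum; apply: eq_bigr => a _ /=.
by rewrite dehomM dehom_syz dehom_mderiv dehom_curve.
Qed.

Variable c : 'I_(homdim n d) -> L.
Hypothesis cE : forall l : 'I_(homdim n d), (tangent_coefs mu)`_l = c l.

(** The Euler relation makes [t] divide the [s]-component; the quotient has the coefficients
    recorded in [c], and cancelling [t] gives the other component. *)
Lemma tangent_formE (d_gt1 : (1 < d)%N) j :
  tangent_form s j = vt * homOf n d c j /\ tangent_form t j = - (vs * homOf n d c j).
Proof.
have e_gt0 : (0 < (edeg n d j).-1)%N by rewrite edegE; lia.
have es : tangent_form s j = vt * homOf n d c j.
  rewrite -(homogenizeK (tangent_form_homog s j)) dehom_tangent /homogenize big_ord_recr /=.
  (* Writing [e] for [edeg n d j], this is the coefficient of degree [e] of the dehomogenised Euler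
     relation, to which the [t]-component, of degree at most [e-1], contributes 0. *)
  have -> : (tangent_comp mu j)`_(edeg n d j).-1 = 0.
    have := congr1 (fun P => (dehom P)`_(edeg n d j).-1.+1) (tangent_form_euler j).
    rewrite rmorph0 coef0 dehomD !dehomM dehom_vs dehom_vt dehom_tangent mul1r.
    rewrite coefD coefXM /= [X in _ + X]nth_default ?addr0 //.
    exact: size_dehom (tangent_form_homog t j).
  rewrite scale0r addr0 /homOf mulr_sumr; apply: eq_bigr => k _.
  rewrite (coordAt_flat (b := fun j k => (tangent_comp mu j)`_k)) //.
  rewrite -scalerAr mulrCA -exprS; congr (_ *: (_ * _ ^+ _)).
  by have := ltn_ord k; lia.
split=> //; apply: (mulfI (x := vt)); first exact: mpolyXU_neq0.
have := tangent_form_euler j; rewrite es => /eqP.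
by rewrite addrC addr_eq0 => /eqP ->; rewrite mulrN mulrCA.
Qed.

Lemma realizes_homOf (d_gt1 : (1 < d)%N) :
  (forall x, nonzero_pt x -> exists j, meval x (homOf n d c j) != 0) ->
  realizes n d (homOf n d c).
Proof.
move=> nozero.
have curve_nz x : nonzero_pt x -> exists i, meval x (curve_form i) != 0.
  move=> nzx; apply/existsP; apply: contraT; rewrite negb_exists => /forallP G0.
  have [j] := nozero x nzx; case/negP.
  (* Differentiating [M G = 0] at a common zero of the [G_a] leaves only the terms containing
     derivatives of [G_a]. *)
  have tan0 i : meval x (tangent_form i j) = 0.
    transitivity (meval x (\sum_a syz_form j a * curve_form a)^`M(i)); last first.
      by rewrite syz_curve mderiv0 meval0.
    rewrite /tangent_form (raddf_sum (mderiv i)) !(raddf_sum (meval x)) /=.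
    apply: eq_bigr => a _.
    rewrite mderivM mevalD ![meval x (syz_form _ _ * _)]mevalM [meval x (_ * curve_form a)]mevalM.
    by rewrite (eqP (negbNE (G0 a))) mulr0 add0r.
  have [es et] := tangent_formE d_gt1 j; move: (tan0 s) (tan0 t); rewrite es et.
  rewrite mevalN !mevalM !mevalXU => /eqP e1 /eqP; rewrite oppr_eq0 => e2.
  by case: nzx => nz; [move: e2 | move: e1]; rewrite mulf_eq0 (negPf nz).
exists curve_form; split; first exact: curve_form_homog.
split=> //; exists syz_form; split; first exact: syz_form_homog.
split; first exact: syz_curve.
split; last by split=> j; case: (tangent_formE d_gt1 j).
move=> x /curve_nz[i]; rewrite /curve_form mevalM mulf_eq0 negb_or => /andP[_ nzdet].
set M := \matrix_(_, _) _; rewrite -kermx_eq0; set w := kermx M.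
(* Where [G_i] is nonzero, deleting column [i] leaves an invertible matrix, so the rows of [M] are
   independent. *)
set S := \matrix_(a, b) syz_form a (lift i b) in nzdet.
have wS : w *m map_mx (meval x) S = 0.
  apply/matrixP=> a b; rewrite [RHS]mxE.
  transitivity ((w *m M) a (lift i b)); last by rewrite mulmx_ker mxE.
  by rewrite !mxE; apply: eq_bigr => k _; rewrite !mxE.
have uS : map_mx (meval x) S \in unitmx by rewrite unitmxE det_map_mx unitfE.
by rewrite -(mulmxK uS w) wS mul0mx.
Qed.

End Realization.

Lemma tangent_coefs_map n d (R S : comNzRingType) (f : {rmorphism R -> S})
    (mu : coord_index n d -> R) (nu : coord_index n d -> S) :
  (forall t, f (mu t) = nu t) -> map f (tangent_coefs mu) = tangent_coefs nu.
Proof.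
move=> munu; have syzE j i : map_poly f (syz_entry mu j i) = syz_entry nu j i.
  apply/polyP=> k; rewrite coef_map !coef_poly.
  by case: ifP => _; [exact: munu | exact: rmorph0].
have curveE i : map_poly f (curve_coord mu i) = curve_coord nu i.
  rewrite rmorphM rmorph_sign -det_map_mx; congr (_ * \det _).
  by apply/matrixP=> a b; rewrite !mxE /= syzE.
rewrite /tangent_coefs /flat_coefs map_flatten -map_comp; congr flatten; apply: eq_map => j /=.
rewrite -map_comp; apply: eq_map => k /=; rewrite -coef_map; congr ((polyseq _)`_k).
rewrite /tangent_comp (raddf_sum (map_poly f)) /=.
by apply: eq_bigr => i _; rewrite -curveE deriv_map -syzE -rmorphM.
Qed.

(** Surviving leading coefficients keep both sizes, so the two Sylvester matrices have the same
    shape. *)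
Lemma resultant_map (R S : nzRingType) (f : {rmorphism R -> S}) (p q : {poly R}) :
  f (lead_coef p) != 0 -> f (lead_coef q) != 0 ->
  f (resultant p q) = resultant (map_poly f p) (map_poly f q).
Proof.
move=> nzp nzq; rewrite /resultant /Sylvester_mx !size_map_poly_id0 // -det_map_mx.
congr (\det _); apply/matrixP=> i j; rewrite [LHS]mxE.
rewrite -[RHS]/((col_mx _ _) i j) !mxE; case: (split i) => k;
  by rewrite !mxE /= !rVpoly_delta !coefXnM; case: ltnP => _; rewrite ?rmorph0 ?coef_map.
Qed.

(** * A nonzero polynomial whose nonvanishing excludes common zeros of [f] *)

Section NoCommonZero.
Variables (K : fieldType) (n d : nat) (j0 j1 : 'I_n).
Hypotheses (d_gt2 : (2 < d)%N) (j01 : j0 != j1).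
Notation N := (homdim n d).

Definition varAt (k : nat) : {mpoly K[N]} :=
  if insub k is Some i then 'X_i else 0.

Definition gen_comp (j : 'I_n) : {poly {mpoly K[N]}} :=
  \poly_(k < (edeg n d j).-1) varAt (homoff n d j + k).

Definition comp_poly (L : fieldType) (c : 'I_N -> L) (j : 'I_n) : {poly L} :=
  \poly_(k < (edeg n d j).-1) coordAt c (homoff n d j + k).

(** The first factor excludes the point [t = 0] as a zero of component [j0]; the resultant excludes
    common zeros of components [j0] and [j1] elsewhere. *)
Definition separating : {mpoly K[N]} :=
  varAt (homoff n d j0 + (edeg n d j0).-2) * resultant (gen_comp j0) (gen_comp j1).

Lemma edeg_gt2 (j : 'I_n) : (2 < edeg n d j)%N.
Proof. by rewrite edegE; lia. Qed.

Lemma map_varAt (L : fieldType) (f : {rmorphism {mpoly K[N]} -> L}) k :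
  f (varAt k) = coordAt (fun i => f 'X_i) k.
Proof. by rewrite /varAt /coordAt; case: insub => [i|]; rewrite ?rmorph0. Qed.

Lemma map_gen_comp (L : fieldType) (f : {rmorphism {mpoly K[N]} -> L}) j :
  map_poly f (gen_comp j) = comp_poly (fun i => f 'X_i) j.
Proof.
apply/polyP=> k; rewrite coef_map !coef_poly.
by case: ifP => _; [exact: map_varAt | exact: rmorph0].
Qed.

Lemma size_gen_comp j : size (gen_comp j) = (edeg n d j).-1.
Proof.
have e := edeg_gt2 j; rewrite size_poly_eq //.
have lt : ((edeg n d j).-2 < (edeg n d j).-1)%N by lia.
have [ltN _] := nth_flat_coefs (fun _ _ => 0 : K) lt.
by rewrite /varAt insubT mpolyXU_neq0.
Qed.

Lemma separating_neq0 : separating != 0.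
Proof.
(* The witness has component [s^m] at [j0] and [s^m + t^m] at the other indices, with [m = e_j - 2]:
   leading coefficients are 1, and the components at [j0] and [j1] are coprime. *)
pose b (j : 'I_n) (k : nat) : K :=
  if j == j0 then (k == (edeg n d j).-2)%:R else (k == 0%N)%:R + (k == (edeg n d j).-2)%:R.
pose c (l : 'I_N) := (flat_coefs d b)`_l.
have cE j k : (k < (edeg n d j).-1)%N -> coordAt c (homoff n d j + k) = b j k.
  by move=> lt; apply: coordAt_flat.
pose f : {rmorphism {mpoly K[N]} -> K} := meval c.
have fX : (fun i => f 'X_i) =1 c by move=> i; rewrite /f /= mevalXU.
have coordE k : coordAt (fun i => f 'X_i) k = coordAt c k.
  by rewrite /coordAt; case: insub.
have compE j : map_poly f (gen_comp j) = \poly_(k < (edeg n d j).-1) b j k.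
  rewrite map_gen_comp; apply/polyP=> k; rewrite !coef_poly.
  by case: ifP => // lt; rewrite coordE cE.
have top j : f (lead_coef (gen_comp j)) = 1.
  have e := edeg_gt2 j; rewrite lead_coefE size_gen_comp coef_poly.
  have lt : ((edeg n d j).-2 < (edeg n d j).-1)%N by lia.
  rewrite lt map_varAt coordE cE // /b eqxx; case: ifP => // _.
  by rewrite gtn_eqF ?add0r //; lia.
suff : f separating != 0 by apply: contraNneq => ->; rewrite rmorph0.
rewrite rmorphM map_varAt coordE cE; last by have := edeg_gt2 j0; lia.
rewrite {1}/b !eqxx mul1r resultant_map ?top ?oner_neq0 // !compE resultant_eq0 -leqNgt.
have -> : \poly_(k < (edeg n d j0).-1) b j0 k = 'X^((edeg n d j0).-2).
  apply/polyP=> k; rewrite coef_poly coefXn /b eqxx; case: ltnP => // le.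
  by rewrite gtn_eqF //; have := edeg_gt2 j0; lia.
have -> : \poly_(k < (edeg n d j1).-1) b j1 k = 'X^((edeg n d j1).-2) + 1.
  have e := edeg_gt2 j1.
  apply/polyP=> k; rewrite coef_poly coefD coefXn coef1 /b eq_sym (negPf j01) addrC.
  by case: ltnP => // le; rewrite !gtn_eqF ?addr0 //; lia.
have : coprimep ('X^((edeg n d j0).-2) : {poly K}) ('X^((edeg n d j1).-2) + 1).
  apply: coprimep_expl; rewrite coprimep_sym coprimepX rootE hornerD hornerXn hornerC.
  by rewrite expr0n /= (_ : _ == 0 = false)%N ?add0r ?oner_neq0 //; have := edeg_gt2 j1; lia.
by rewrite coprimep_def => /eqP ->.
Qed.

Lemma separating_no_common_zero (L : fieldType) (f : {rmorphism {mpoly K[N]} -> L})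
    (c : 'I_N -> L) :
  (forall i, f 'X_i = c i) -> f separating != 0 ->
  forall x, nonzero_pt x -> exists j, meval x (homOf n d c j) != 0.
Proof.
move=> fX; rewrite rmorphM mulf_eq0 negb_or map_varAt => /andP[nztop nzres] x nzx.
have coordE k : coordAt (fun i => f 'X_i) k = coordAt c k.
  by rewrite /coordAt; case: insub => // i; rewrite fX.
rewrite coordE in nztop.
have [z0|] := eqVneq (meval x (homOf n d c j0)) 0; last by exists j0.
have [z1|] := eqVneq (meval x (homOf n d c j1)) 0; last by exists j1.
have homE j : meval x (homOf n d c j) = \sum_(k < (edeg n d j).-1)
    coordAt c (homoff n d j + k) * (x ord0 ^+ k * x ord_max ^+ ((edeg n d j).-2 - k)).
  rewrite (raddf_sum (meval x)); apply: eq_bigr => k _ /=.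
  by rewrite mevalZ mevalM !rmorphXn /= !mevalXU.
(* At [t = 0] only the top power of [s] remains; elsewhere [s/t] is a root of both dehomogenised
   components. *)
have [x1|nx1] := eqVneq (x ord_max) 0.
  case: nzx => [nx0|]; last by rewrite x1 eqxx.
  move: z0; rewrite homE; have := edeg_gt2 j0; case E : (edeg n d j0) nztop => [|[|e]] //= nztop _.
  rewrite big_ord_recr big1 /= => [|k _]; last first.
    by rewrite x1 expr0n subn_eq0 leqNgt ltn_ord /= !mulr0.
  by rewrite add0r subnn mulr1 => /eqP; rewrite mulf_eq0 (negPf nztop) expf_eq0 (negPf nx0) andbF.
have rootE j : meval x (homOf n d c j) = 0 -> (map_poly f (gen_comp j)).[x ord0 / x ord_max] = 0.
  move=> zj; apply: (mulfI (expf_neq0 (edeg n d j).-2 nx1)); rewrite mulr0 -[RHS]zj homE.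
  rewrite map_gen_comp horner_poly mulr_sumr; apply: eq_bigr => k _.
  rewrite coordE mulrCA; congr (_ * _); rewrite expr_div_n.
  have le : (k <= (edeg n d j).-2)%N by have := ltn_ord k; have := edeg_gt2 j; lia.
  by rewrite -{1}(subnK le) exprD mulrACA divff ?expf_neq0 // mulr1 mulrC.
case/negP: nzres; have gt1 j : (1 < size (gen_comp j))%N.
  by rewrite size_gen_comp; have := edeg_gt2 j; lia.
(* Ideal membership is stated for the generic components and specialised afterwards, so leading
   coefficients that vanish under [f] do no harm. *)
have [[u v] _ /= e] := resultant_in_ideal (gt1 j0) (gt1 j1).
have := congr1 (fun p => (map_poly f p).[x ord0 / x ord_max]) e.
by rewrite map_polyC hornerC rmorphD !rmorphM hornerD !hornerM /= !rootE // !mulr0 addr0 => ->.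
Qed.

End NoCommonZero.

(* Found by search.  The parity pattern keeps the Jacobian matrix sparse; the
   plain pattern [k + i + j] gives a rank drop at [(n, d) = (4, 7)]. *)
Definition check_point (d j i k : nat) : Z :=
  (if odd (k + i + (if d < 10 then j %% 3 else j)) then Z0
   else Z.of_nat (1 + ((i + j) ^ 2 + 3 * k) %% 7 %% 4))%N.

(** * Machine check of the rank and conclusion *)

Definition homdim_nat (n d : nat) := sumn [seq (edeg_nat n d j).-1 | j <- iota 0 n].

Definition full_rank_at (n d : nat) : bool :=
  full_rank_mod (Z.of_nat 127) (homdim_nat n d) (tangent_rows n d (check_point d)).

(** The second argument of [iota] is a length: the ranges of [d] are [3..25], [4..17], [6..12] and
    [7..9]. *)
Lemma full_rank_cases :
  [&& all (full_rank_at 2) (iota 3 23), all (full_rank_at 3) (iota 4 14),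
      all (full_rank_at 4) (iota 6 7) & all (full_rank_at 5) (iota 7 3)].
Proof. by vm_cast_no_check (erefl true). Qed.

Lemma homdim_natE n d : homdim_nat n d = homdim n d.
Proof. by rewrite /homdim_nat sumnE big_map -val_enum_ord big_map big_enum. Qed.

Lemma cases_full_rank n d : theorem1p2_cases n d ->
  [/\ (1 < n)%N, (2 < d)%N & full_rank_at n d].
Proof.
have /and4P[/allP r2 /allP r3 /allP r4 /allP r5] := full_rank_cases.
case/or4P => /andP[/eqP -> /andP[le1 le2]]; split=> //.
all: try by apply: leq_trans le1.
- by apply: r2; rewrite mem_iota le1.
- by apply: r3; rewrite mem_iota le1.
- by apply: r4; rewrite mem_iota le1.
- by apply: r5; rewrite mem_iota le1.
Qed.

Theorem theorem1p2 (K : fieldType) (L : closedFieldType)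
    (iota : {rmorphism K -> L}) (charK0 : [pchar K] =i pred0)
    (n d : nat) (hnd : theorem1p2_cases n d) :
  exists h : {mpoly K[homdim n d]}, h != 0 /\
    forall c : 'I_(homdim n d) -> L,
      meval c (map_mpoly iota h) != 0 -> realizes n d (homOf n d c).
Proof.
have [n_gt1 d_gt2 full] := cases_full_rank hnd.
rewrite /full_rank_at homdim_natE in full.
have [f nzJ] := tangent_map_dominant charK0 (isT : prime 127) full.
have [h0 nzh0 lift] := generic_lift iota (jacobian_indep charK0 nzJ).
have n_gt0 := ltnW n_gt1.
pose j0 := Ordinal n_gt0; pose j1 := Ordinal n_gt1.
have j01 : j0 != j1 by [].
(* The factor [h0] guarantees a preimage of [c] under the tangent map, and [separating] guarantees
   that the resulting [f] has no common zero. *)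
exists (h0 * separating K d j0 j1); split; first by rewrite mulf_neq0 // separating_neq0.
move=> c; rewrite rmorphM mevalM mulf_eq0 negb_or => /andP[/lift[x xE] nzsep].
pose ev : {rmorphism {mpoly K[#|coord_index n d|]} -> L} := (meval x \o map_mpoly iota)%FUN.
apply: (@realizes_homOf _ _ _ (fun t => x (enum_rank t))) => //.
- exact: ltnW (ltnW d_gt2).
- move=> l; rewrite -xE.
  have -> : tangent_coefs (fun t => x (enum_rank t)) =
      map ev (tangent_coefs (gen_coord K (n := n) (d := d))).
    by apply/esym/tangent_coefs_map => t; rewrite /ev /= map_mpolyX mevalXU.
  by rewrite (nth_map 0) // size_tangent_coefs.
- exact: ltnW.
pose ev' : {rmorphism {mpoly K[homdim n d]} -> L} := (meval c \o map_mpoly iota)%FUN.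
apply: (separating_no_common_zero d_gt2 j01 (f := ev') (c := c)) => // i.
by rewrite /ev' /= map_mpolyX mevalXU.
Qed.
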